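(* Let $G$ and $H$ be Lie groups, let $\Theta: G\to \mathrm{Aut}(H)$ be an action of $G$ on $H$, let $\mathfrak{h}$ be the Lie algebra of $H$, and let $D:G\to H$ be a crossed homomorphism with respect to $\Theta$. Then the map $\Theta_D: G\to \mathrm{GL}(\mathfrak{h})$ defined by $$\Theta_D(a)u=\mathrm{Ad}_{D(a)}\tilde{\Theta}(a)u,\qquad a\in G,\ u\in\mathfrak{h},$$ is a representation of $G$ on $\mathfrak{h}$.
   Context: An action $\Theta:G\to\mathrm{Aut}(H)$ is a (smooth) action of $G$ on $H$ by Lie group automorphisms. A crossed homomorphism with respect to $\Theta$ is a smooth map $D:G\to H$ with $D(ab)=D(a)\cdot(\Theta(a)D(b))$ for all $a,b\in G$. $\tilde\Theta:G\to\mathrm{Aut}(\mathfrak h)$ is the induced Lie group homomorphism $\tilde\Theta(a)=\Theta(a)_{*e_H}$, the tangent map of $\Theta(a)$ at the identity $e_H$. $\mathrm{Ad}$ is the adjoint action of $H$ on $\mathfrak h$, $\mathrm{Ad}_h u=\frac{d}{dt}\big|_{t=0}h\exp(tu)h^{-1}$. *)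

(* Defs.v *)
From HB Require Import structures.
From mathcomp Require Import all_boot all_order all_algebra.
From mathcomp Require Import all_classical all_reals all_analysis.

Set Implicit Arguments.
Unset Strict Implicit.
Unset Printing Implicit Defensive.

Import Order.TTheory GRing.Theory Num.Theory.
Import numFieldNormedType.Exports.

Local Open Scope classical_set_scope.
Local Open Scope ring_scope.

(* [f] is of class C^k on the open set [U]: for k + 1, [f] is Fréchet
   differentiable on [U] and all its directional derivatives are of class C^k.
   In finite dimension, the only case used below, this is the usual notion. *)
Fixpoint Ck_on {R : realType} {V W : normedModType R} (k : nat)
    (U : set V) (f : V -> W) : Prop :=
  match k with
  | 0%N => forall x, U x -> {for x, continuous f}
  | k'.+1 => (forall x, U x -> differentiable f x) /\
             (forall v : V, Ck_on k' U (fun x => 'd f x v))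
  end.

Definition smooth_on {R : realType} {V W : normedModType R}
    (U : set V) (f : V -> W) : Prop := forall k, Ck_on k U f.

(* Only the values of [coord] on [dom] and of [coordV] on [coord @` dom] are
   meaningful. *)
Record chart (M V : Type) := Chart {
  dom : set M;
  coord :> M -> V;
  coordV : V -> M }.

Record is_chart {R : realType} {M : topologicalType} {V : normedModType R}
    (c : chart M V) : Prop := IsChart {
  chart_dom_open : open (dom c);
  chart_img_open : open (c @` dom c);
  chart_cancel : forall x, dom c x -> coordV c (c x) = x;
  chart_continuous : forall x, dom c x -> {for x, continuous c};
  chartV_continuous : forall v, (c @` dom c) v -> {for v, continuous (coordV c)}
}.

Definition prod_chart {M N V W : Type} (c : chart M V) (d : chart N W) :
    chart (M * N) (V * W) :=
  Chart [set p | dom c p.1 /\ dom d p.2]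
        (fun p => (c p.1, d p.2))
        (fun q => (coordV c q.1, coordV d q.2)).

Definition prod_atlas {M N V W : Type}
    (A : set (chart M V)) (B : set (chart N W)) : set (chart (M * N) (V * W)) :=
  [set e | exists c d, [/\ A c, B d & e = prod_chart c d]].

Definition vec_atlas (V : Type) : set (chart V V) := [set Chart setT id id].

Definition smooth_wrt {R : realType} {M N : topologicalType}
    {V W : normedModType R} (A : set (chart M V)) (B : set (chart N W))
    (f : M -> N) : Prop :=
  continuous f /\
  forall c d, A c -> B d ->
    smooth_on (c @` (dom c `&` f @^-1` dom d)) (fun v => d (f (coordV c v))).

HB.mixin Record isManifold (R : realType) (n : nat) M of Topological M := {
  atlas : set (chart M 'rV[R]_n);
  atlas_chart : forall c, atlas c -> is_chart c;
  atlas_cover : forall x : M, exists c, atlas c /\ dom c x;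
  atlas_compat : forall c d, atlas c -> atlas d ->
    smooth_on (c @` (dom c `&` dom d)) (fun v => d (coordV c v));
  manifold_hausdorff : hausdorff_space M;
  manifold_second_countable : @second_countable M }.

#[short(type="manifoldType")]
HB.structure Definition Manifold (R : realType) (n : nat) :=
  {M of isManifold R n M & Topological M}.

Arguments atlas {R n} M : rename.

HB.mixin Record isLieGroup (R : realType) (n : nat) G
    of Manifold R n G & Group G := {
  mulg_smooth : smooth_wrt (prod_atlas (atlas G) (atlas G)) (atlas G)
                  (fun p : G * G => (p.1 * p.2)%g);
  invg_smooth : smooth_wrt (atlas G) (atlas G) (fun x : G => (x^-1)%g) }.

#[short(type="lieGroupType")]
HB.structure Definition LieGroup (R : realType) (n : nat) :=
  {G of isLieGroup R n G & Manifold R n G & Group G}.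

Definition chart_at {R : realType} {n : nat} {M : manifoldType R n} (x : M) :
    chart M 'rV[R]_n :=
  sval (cid (atlas_cover x)).

(* The tangent space at [x] is identified with the model space through the
   preferred chart [chart_at x]. Tangent spaces at distinct points thus have
   convertible types, but the coordinates refer to the preferred chart of the
   base point, as in [velocity] and [tangent_map]. *)
Definition tangent {R : realType} {n : nat} {M : manifoldType R n} (x : M) :
    normedModType R := 'rV[R]_n.

Definition velocity {R : realType} {n : nat} {M : manifoldType R n}
    (g : R -> M) (t : R) : tangent (g t) :=
  derive1 (fun s : R => chart_at (g t) (g s)) t.

Definition tangent_map {R : realType} {m n : nat}
    {M : manifoldType R m} {N : manifoldType R n}
    (f : M -> N) (x : M) (u : tangent x) : tangent (f x) :=
  'd (fun v : 'rV[R]_m => chart_at (f x) (f (coordV (chart_at x) v)))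
     (chart_at x x) u.

Section LieGroups.
Context {R : realType} {n : nat} (H : lieGroupType R n).

(* The underlying vector space of the Lie algebra of [H]. *)
Definition lie_alg : normedModType R := tangent (1%g : H).

Definition one_param_subgroup (u : lie_alg) : set (R -> H) :=
  [set g | [/\ smooth_wrt (@vec_atlas R^o) (atlas H) (g : R^o -> H),
               (forall s t : R, g (s + t) = (g s * g t)%g) &
               velocity g 0 = u :> lie_alg]].

(* The value at 1 of the one-parameter subgroup with initial velocity [u]. *)
Definition lie_exp (u : lie_alg) : H :=
  xget 1%g [set x | exists2 g, one_param_subgroup u g & x = g 1].

(* The curve passes through h * exp(0) * h^-1 = 1 at time 0. *)
Definition Ad (h : H) (u : lie_alg) : lie_alg :=
  velocity (fun t : R => (h * lie_exp (t *: u) * h^-1)%g) 0.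

Record lie_automorphism (f : H -> H) : Prop := LieAutomorphism {
  lie_autM : {morph f : x y / (x * y)%g};
  lie_aut_smooth : smooth_wrt (atlas H) (atlas H) f;
  lie_aut_inv : exists f',
    [/\ cancel f f', cancel f' f & smooth_wrt (atlas H) (atlas H) f'] }.

End LieGroups.

Arguments lie_exp {R n H} u.
Arguments Ad {R n H} h u.

Section Actions.
Context {R : realType} {n m : nat} (G : lieGroupType R n)
  (H : lieGroupType R m).

Record lie_action (Theta : G -> H -> H) : Prop := LieAction {
  lie_act_aut : forall a, lie_automorphism (Theta a);
  lie_act1 : forall x, Theta 1%g x = x;
  lie_actM : forall a b x, Theta (a * b)%g x = Theta a (Theta b x);
  lie_act_smooth : smooth_wrt (prod_atlas (atlas G) (atlas H)) (atlas H)
                     (fun p : G * H => Theta p.1 p.2) }.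

Record crossed_hom (Theta : G -> H -> H) (D : G -> H) : Prop := CrossedHom {
  crossed_smooth : smooth_wrt (atlas G) (atlas H) D;
  crossedM : forall a b, D (a * b)%g = (D a * Theta a (D b))%g }.

(* [Theta a] fixes 1, so that its tangent map at 1 takes values in the tangent
   space at 1. *)
Definition tilde_action (Theta : G -> H -> H) (a : G) (u : lie_alg H) :
    lie_alg H :=
  tangent_map (Theta a) (u : tangent (1%g : H)).

(* A Lie group homomorphism from [G] to GL(V), V = R^m. As GL(V) is an open
   subset of the space of endomorphisms, smoothness is that of the matrix. *)
Record representation (rho : G -> 'rV[R]_m -> 'rV[R]_m) : Prop :=
  Representation {
  rep_linear : forall a, linear (rho a);
  rep_bij : forall a, bijective (rho a);
  repM : forall a b u, rho (a * b)%g u = rho a (rho b u);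
  rep_smooth : smooth_wrt (atlas G) (@vec_atlas 'M[R]_m)
                 (fun a => lin1_mx (rho a)) }.

End Actions.

(* Main.v *)
Require Import Defs.
From HB Require Import structures.
From mathcomp Require Import all_boot all_order all_algebra.
From mathcomp Require Import all_classical all_reals all_analysis.
From mathcomp Require Import ring lra.

Set Implicit Arguments.
Unset Strict Implicit.
Unset Printing Implicit Defensive.

Import Order.TTheory GRing.Theory Num.Theory.
Import numFieldNormedType.Exports.

Local Open Scope classical_set_scope.
Local Open Scope ring_scope.

(** The map [Theta_D a] is the tangent map at 1 of the smooth group
    endomorphism [twisted a : x |-> D a * Theta a x * (D a)^-1] of [H]. The
    crossed homomorphism identity implies that
    [twisted (a * b) = twisted a \o twisted b], and it forces [D 1 = 1], so
    [twisted 1 = id]. By the chain rule [a |-> Theta_D a] is multiplicative and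
    sends 1 to the identity; linearity and invertibility follow. It is smooth
    because a partial differential of the smooth map
    [(a, x) |-> twisted a x] depends smoothly on [a] ([diff1_twisted_smooth]).

    The work lies in identifying [Ad h], defined by differentiating
    [h * exp (t u) * h^-1], with the tangent map of conjugation ([Ad_diff1]).
    This needs the exponential map to exist, that is, each tangent vector [u] at
    1 to be the velocity of exactly one one-parameter subgroup. The proof does
    not solve a differential equation. It works in a chart centred at 1, where
    the product of [x] and [y] is [x + y] up to a quadratic error
    ([C2_quadratic], [mul_near1]), and rests on curves [g] such that
    [g (2 t) = g t ^ 2] and [g t = t u + O (t ^ 2)].

    - Uniqueness ([doubling_unique]): squaring is 3-Lipschitz near 1, while
      halving [t] divides an error in [t ^ 2] by 4. Iterating, the distance
      between two such curves is at most a constant times [(3 / 4) ^ k] for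
      every [k].
    - Existence ([local_curve], [global_curve]): for the same reason the iterated
      squares of [t u / 2 ^ k] form a Cauchy sequence, as [k] tends to infinity.
    - Additivity ([doubling_morph]): applying uniqueness to powers and inverses
      of [g] shows that the values of [g] at commensurable times commute; by
      continuity all its values commute, so [t |-> g (a t) * g (b t)] is again
      such a curve, and uniqueness identifies it with [t |-> g ((a + b) t)].
    - Smoothness ([hom_smooth]): the homomorphism property turns
      differentiability at 0 into the equation [g' = X (g)], where [X] is the
      left-invariant field of [u], and this equation raises the regularity of
      [g] by one order at a time. *)

(** * Calculus of C^k maps *)

Lemma continuous_near_eq (T S : topologicalType) (f g : T -> S) (x : T) :
  (\forall y \near x, f y = g y) -> {for x, continuous f} -> {for x, continuous g}.
Proof.
move=> fg cf; have fgx : f x = g x := nbhs_singleton fg.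
suff : g y @[y --> x] --> g x by [].
rewrite -fgx; apply: cvg_trans cf; apply: near_eq_cvg.
exact: fg.
Qed.

Section Ck.
Context {R : realType}.
Implicit Types V W X : normedModType R.

Lemma is_diff_remainder V W (f : V -> W) (df : {linear V -> W}) x :
  continuous df -> f \o shift x = cst (f x) + df +o_ 0 id -> is_diff x f df.
Proof.
move=> cdf key; have E := diff_unique cdf key.
by apply: DiffDef; [apply/diff_locallyP; rewrite E; split|exact: E].
Qed.

Lemma diff_near_eq V W (f g : V -> W) (x : V) :
  (\forall y \near x, f y = g y) -> differentiable f x ->
  differentiable g x /\ 'd g x = 'd f x :> (V -> W).
Proof.
move=> fg df.
have fgx : f x = g x := nbhs_singleton fg.
have key : g \o shift x = cst (g x) + 'd f x +o_ 0 id.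
  apply/eqaddoP => _/posnumP[e].
  have /eqaddoP /(_ _ (gt0 e)) := diff_locally df.
  have fg0 : \forall h \near (0 : V), f (h + x) = g (h + x).
    by move: fg; rewrite (near_shift 0) /= subr0.
  apply: filterS2 fg0 => h /= E.
  by rewrite !fctE /= E fgx.
have dg := is_diff_remainder (diff_continuous df) key.
by split; [exact: (@ex_diff _ _ _ _ _ _ _ dg)|exact: (@diff_val _ _ _ _ _ _ _ dg)].
Qed.

Lemma is_diff_near_eq V W (f g df : V -> W) x :
  (\forall y \near x, f y = g y) -> is_diff x f df -> is_diff x g df.
Proof. by move=> /diff_near_eq fg [/fg[dg E] <-]; split. Qed.

(** The partial maps of a differentiable map are its composites with the two
    affine embeddings of the factors. *)
Lemma diff_slice V W X (f : V * W -> X) x y :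
  differentiable f (x, y) ->
  (differentiable (fun v => f (v, y)) x /\
   forall v, 'd (fun v => f (v, y)) x v = 'd f (x, y) (v, 0)) /\
  (differentiable (fun w => f (x, w)) y /\
   forall w, 'd (fun w => f (x, w)) y w = 'd f (x, y) (0, w)).
Proof.
move=> df; split.
  have d1 : is_diff x (fun v : V => (v, y)) (fun v => (v, (0 : W))).
    by apply: is_diff_pair.
  have d2 := is_diff_comp d1 (differentiableP df).
  split; first exact: (@ex_diff _ _ _ _ _ _ _ d2).
  move=> v; exact: (congr1 (fun h : V -> X => h v) (@diff_val _ _ _ _ _ _ _ d2)).
have d1 : is_diff y (fun w : W => (x, w)) (fun w => ((0 : V), w)).
  by apply: is_diff_pair.
have d2 := is_diff_comp d1 (differentiableP df).
split; first exact: (@ex_diff _ _ _ _ _ _ _ d2).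
move=> w; exact: (congr1 (fun h : W -> X => h w) (@diff_val _ _ _ _ _ _ _ d2)).
Qed.

Lemma open_near_eq (T : topologicalType) (S : Type) (U : set T) (f g : T -> S) x :
  open U -> (forall x, U x -> f x = g x) -> U x -> \forall y \near x, f y = g y.
Proof. by move=> oU fg Ux; apply: filterS (open_nbhs_nbhs (conj oU Ux)). Qed.

(** Openness of [U] is what makes equality on [U] an equality of germs, hence
    of all derivatives. *)
Lemma Ck_on_eq k V W (U : set V) (f g : V -> W) :
  open U -> (forall x, U x -> f x = g x) -> Ck_on k U f -> Ck_on k U g.
Proof.
move=> oU; elim: k f g => [|k IH] f g fg /=.
  by move=> cf x Ux; apply: continuous_near_eq (open_near_eq oU fg Ux) (cf x Ux).
move=> [df Hf]; split=> [x Ux|v].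
  by have [] := diff_near_eq (open_near_eq oU fg Ux) (df x Ux).
apply: IH (Hf v) => x Ux.
by have [_ ->] := diff_near_eq (open_near_eq oU fg Ux) (df x Ux).
Qed.

Lemma Ck_on_sub k V W (U U' : set V) (f : V -> W) :
  U' `<=` U -> Ck_on k U f -> Ck_on k U' f.
Proof.
move=> UU; elim: k f => [|k IH] f /=; first by move=> cf x /UU /cf.
by move=> [df Hf]; split=> [x /UU/df//|v]; apply: IH.
Qed.

(** Each condition in the definition of [Ck_on] is about the germ of the map
    at one point. *)
Lemma Ck_on_local k V W (U : set V) (f : V -> W) :
  (forall x, U x -> exists2 U', U' x & Ck_on k U' f) -> Ck_on k U f.
Proof.
elim: k f => [|k IH] f /= H.
  by move=> x /H[U' U'x]; apply.
split=> [x /H[U' U'x [df _]]|v]; first exact: df.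
by apply: IH => x /H[U' U'x [_ Hf]]; exists U'.
Qed.

Lemma Ck_onS k V W (U : set V) (f : V -> W) : Ck_on k.+1 U f -> Ck_on k U f.
Proof.
elim: k f => [|k IH] f [df Hf].
  by move=> x Ux; apply: differentiable_continuous; apply: df.
by split=> // v; apply: IH; apply: Hf.
Qed.

Lemma Ck_on_cst k V W (U : set V) (a : W) : Ck_on k U (fun _ : V => a).
Proof.
elim: k a => [|k IH] a /=; first by move=> x _; apply: cvg_cst.
split=> [x _|v]; first exact: differentiable_cst.
suff -> : (fun x : V => 'd (fun=> a) x v) = (fun=> 0) by [].
by apply/funext => x; rewrite diff_cst.
Qed.

Lemma Ck_on_linear k V W (U : set V) (f : {linear V -> W}) :
  continuous f -> Ck_on k U f.
Proof.
move=> cf; case: k => [|k] /=; first by move=> x _; apply: cf.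
split=> [x _|v]; first exact: linear_differentiable.
suff -> : (fun x : V => 'd f x v) = (fun=> f v) by apply: Ck_on_cst.
by apply/funext => x; rewrite diff_lin.
Qed.

Lemma Ck_on_add k V W (U : set V) (f g : V -> W) : open U ->
  Ck_on k U f -> Ck_on k U g -> Ck_on k U (fun x => f x + g x).
Proof.
move=> oU; elim: k f g => [|k IH] f g /=.
  by move=> cf cg x Ux; apply: cvgD; [exact: cf|exact: cg].
move=> [df Hf] [dg Hg]; split=> [x Ux|v].
  by apply: differentiableD; [exact: df|exact: dg].
apply: Ck_on_eq (IH _ _ (Hf v) (Hg v)) => // x Ux.
exact: (esym (congr1 (fun h : V -> W => h v) (diffD (df x Ux) (dg x Ux)))).
Qed.

Lemma Ck_on_sum k V W (U : set V) (I : Type) (r : seq I) (f : I -> V -> W) :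
  open U -> (forall i, Ck_on k U (f i)) -> Ck_on k U (fun x => \sum_(i <- r) f i x).
Proof.
move=> oU Hf; elim: r => [|i r IH].
  by apply: Ck_on_eq (Ck_on_cst k U 0) => // x _; rewrite big_nil.
by apply: Ck_on_eq (Ck_on_add oU (Hf i) IH) => // x _; rewrite big_cons.
Qed.

Lemma Ck_on_linear_comp k V W X (U : set V) (f : V -> W) (L : {linear W -> X}) :
  open U -> continuous L -> Ck_on k U f -> Ck_on k U (fun x => L (f x)).
Proof.
move=> oU cL; elim: k f => [|k IH] f /=.
  move=> cf x Ux; apply: (@continuous_comp _ _ _ f L x); [exact: cf|exact: cL].
move=> [df Hf]; split=> [x Ux|v].
  by apply: (differentiable_comp (df x Ux)); exact: linear_differentiable.
apply: Ck_on_eq (IH _ (Hf v)) => // x Ux.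
have dL := linear_differentiable (f x) cL.
have := congr1 (fun h : V -> X => h v) (diff_comp (df x Ux) dL).
by rewrite /comp => ->; rewrite diff_lin.
Qed.

(** By the Leibniz rule, a directional derivative of [B (f x) (g x)] is a sum
    of two expressions of the same form, of class C^(k-1). *)
Lemma Ck_on_bilinear k V W1 W2 X (U : set V) (B : {bilinear W1 -> W2 -> X})
    (f : V -> W1) (g : V -> W2) :
  open U -> continuous (fun p => B p.1 p.2) -> Ck_on k U f -> Ck_on k U g ->
  Ck_on k U (fun x => B (f x) (g x)).
Proof.
move=> oU cB; elim: k f g => [|k IH] f g.
  move=> cf cg x Ux.
  apply: (@continuous_comp _ _ _ (fun x => (f x, g x)) (fun p => B p.1 p.2) x).
    by apply: cvg_pair; [exact: cf|exact: cg].
  exact: cB.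
move=> Hf Hg; have [cf cg] := (Ck_onS Hf, Ck_onS Hg).
move: Hf Hg => [df Hf] [dg Hg]; split=> [x Ux|v].
  apply: (@differentiable_comp _ _ _ _ (fun x => (f x, g x)) (fun p => B p.1 p.2)).
    by apply: differentiable_pair; [exact: df|exact: dg].
  exact: differentiable_bilin.
apply: Ck_on_eq (Ck_on_add oU (IH _ _ cf (Hg v)) (IH _ _ (Hf v) cg)) => // x Ux.
have dfg := differentiable_pair (df x Ux) (dg x Ux).
have dB := differentiable_bilin (f x, g x) cB.
have := congr1 (fun h : V -> X => h v) (diff_comp dfg dB).
by rewrite /comp => ->; rewrite diff_bilin // diff_pair //; [exact: df|exact: dg].
Qed.

Lemma scale_is_bilinear V :
  bilinear_for
    (GRing.Scale.Law.clone _ _ *:%R _) (GRing.Scale.Law.clone _ _ *:%R _)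
    (@GRing.scale R V : R -> V -> V).
Proof.
split=> [u'|u] a x y /=; first by rewrite scalerDl scalerA.
by rewrite scalerDr !scalerA mulrC.
Qed.
HB.instance Definition _ V := bilinear_isBilinear.Build R R V V _ _
  (@GRing.scale R V : R -> V -> V) (scale_is_bilinear V).

Lemma Ck_on_scale k V W (U : set V) (a : V -> R) (f : V -> W) :
  open U -> Ck_on k U a -> Ck_on k U f -> Ck_on k U (fun x => a x *: f x).
Proof.
move=> oU; apply: Ck_on_bilinear => // p; exact: scale_continuous.
Qed.

(** A vector space with a finite family of vectors and continuous coordinate
    functionals: the form of finite dimension that the chain rule uses. It
    passes to products without ordering a basis. *)
Definition finite_frame V := exists (I : finType) (e : I -> V) (l : I -> {linear V -> R}),
  (forall i, continuous (l i)) /\ forall v, v = \sum_i l i v *: e i.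

(** The definition of [Ck_on] speaks of directional derivatives along fixed
    vectors, whereas the chain rule evaluates the differential of [g] along the
    moving vector ['d f x v]. Expanding this vector in a frame turns the
    derivative of the composite into a sum of products of C^(k-1) maps. *)
Lemma Ck_on_comp k V W X (U : set V) (U' : set W) (f : V -> W) (g : W -> X) :
  finite_frame W -> open U -> open U' -> (forall x, U x -> U' (f x)) ->
  Ck_on k U f -> Ck_on k U' g -> Ck_on k U (fun x => g (f x)).
Proof.
move=> [N [e [l [cl fr]]]] oU oU' UU'; elim: k f g UU' => [|k IH] f g UU'.
  move=> cf cg x Ux.
  by apply: (@continuous_comp _ _ _ f g x); [exact: cf|apply/cg/UU'].
move=> Hf; have cf := Ck_onS Hf; case: Hf => [df Hf] [dg Hg]; split=> [x Ux|v].
  by apply: (@differentiable_comp _ _ _ _ f g); [exact: df|apply/dg/UU'].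
have := @Ck_on_sum k V X U _ (index_enum N)
  (fun i x => l i ('d f x v) *: 'd g (f x) (e i)) oU.
move=> /(_ _) H.
apply: Ck_on_eq (H _) => // [x Ux|i].
  have := congr1 (fun h : V -> X => h v) (diff_comp (df x Ux) (dg _ (UU' _ Ux))).
  rewrite /comp => ->; rewrite {2}(fr ('d f x v)) linear_sum.
  by apply: eq_bigr => i _; rewrite linearZ.
apply: Ck_on_scale => //.
  exact: (Ck_on_linear_comp oU (cl i) (Hf v)).
exact (IH f (fun y => 'd g y (e i)) UU' cf (Hg (e i))).
Qed.

Lemma Ck_on_pair k V W X (U : set V) (f : V -> W) (g : V -> X) : open U ->
  Ck_on k U f -> Ck_on k U g -> Ck_on k U (fun x => (f x, g x)).
Proof.
move=> oU; elim: k f g => [|k IH] f g.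
  by move=> cf cg x Ux; apply: cvg_pair; [exact: cf|exact: cg].
move=> [df Hf] [dg Hg]; split=> [x Ux|v].
  by apply: differentiable_pair; [exact: df|exact: dg].
apply: Ck_on_eq (IH _ _ (Hf v) (Hg v)) => // x Ux.
by rewrite diff_pair //; [exact: df|exact: dg].
Qed.

Lemma Ck_on_fst k V W (U : set (V * W)) : Ck_on k U fst.
Proof. by apply: (@Ck_on_linear k _ _ U fst) => x; apply: cvg_fst. Qed.

Lemma Ck_on_snd k V W (U : set (V * W)) : Ck_on k U snd.
Proof. by apply: (@Ck_on_linear k _ _ U snd) => x; apply: cvg_snd. Qed.

Definition mx_coord m n (i : 'I_m) (j : 'I_n) (A : 'M[R]_(m, n)) : R := A i j.

Lemma mx_coord_is_linear m n (i : 'I_m) (j : 'I_n) : linear (mx_coord i j).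
Proof. by move=> a A B; rewrite /mx_coord !mxE. Qed.
HB.instance Definition _ m n (i : 'I_m) (j : 'I_n) :=
  GRing.isLinear.Build R 'M[R]_(m, n) R _ (mx_coord i j) (mx_coord_is_linear i j).

Lemma mx_coord_continuous m n (i : 'I_m) (j : 'I_n) : continuous (@mx_coord m n i j).
Proof. exact: coord_continuous. Qed.

Lemma finite_frame_mx m n : finite_frame 'M[R]_(m, n).
Proof.
exists ('I_m * 'I_n)%type, (fun p => delta_mx p.1 p.2), (fun p => mx_coord p.1 p.2).
split=> [p|A]; first exact: mx_coord_continuous.
by rewrite [LHS]matrix_sum_delta pair_big.
Qed.

Lemma Ck_on_mx k X m n (U : set X) (f : X -> 'M[R]_(m, n)) :
  open U -> (forall i j, Ck_on k U (fun x => mx_coord i j (f x))) -> Ck_on k U f.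
Proof.
move=> oU Hf.
have := @Ck_on_sum k X 'M[R]_(m, n) U _ (index_enum ('I_m * 'I_n)%type)
  (fun p x => mx_coord p.1 p.2 (f x) *: delta_mx p.1 p.2) oU.
move=> H; apply: Ck_on_eq (H _) => // [x _|p].
  by rewrite [RHS]matrix_sum_delta pair_big.
by apply: Ck_on_scale => //; exact: Ck_on_cst.
Qed.

Lemma finite_frameR : finite_frame R.
Proof.
exists unit, (fun=> 1), (fun=> idfun); split=> [i x|v] //.
by rewrite (big_pred1 tt) /= ?[_ *: _]mulr1 // => -[].
Qed.

Lemma finite_frame_pair V W :
  finite_frame V -> finite_frame W -> finite_frame (V * W)%type.
Proof.
move=> [N [e [l [cl fr]]]] [N' [e' [l' [cl' fr']]]].
pose L (k : N + N') : {linear (V * W)%type -> R} :=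
  match k with inl i => (l i \o fst : {linear _ -> _})
             | inr j => (l' j \o snd : {linear _ -> _}) end.
exists (N + N')%type, (fun k => match k with inl i => (e i, 0) | inr j => (0, e' j) end), L.
split=> [k|[v w]].
  by case: k => i x; apply: continuous_comp;
    [exact: cvg_fst|exact: cl|exact: cvg_snd|exact: cl'].
rewrite big_sumType /=.
rewrite [v in LHS]fr [w in LHS]fr'; congr pair => /=.
  rewrite !(raddf_sum fst) /= [X in _ + X]big1 ?addr0 // => i _.
  by rewrite scaler0.
rewrite !(raddf_sum snd) /= [X in X + _]big1 ?add0r // => i _.
by rewrite scaler0.
Qed.

End Ck.

(** * Smooth maps between manifolds *)

Section Charts.
Context {R : realType}.

Lemma open_setI_preimage (M N : topologicalType) (S : set M) (U : set N) (f : M -> N) :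
  open S -> open U -> (forall x, S x -> {for x, continuous f}) ->
  open (S `&` f @^-1` U).
Proof.
move=> oS oU cf; rewrite openE => x [Sx Ufx].
apply: filterI; first exact: open_nbhs_nbhs.
by apply: (cf x Sx); apply: open_nbhs_nbhs.
Qed.

Section OneChart.
Context {M : topologicalType} {V : normedModType R} (c : chart M V).
Hypothesis cc : is_chart c.

(** Domains of coordinate expressions are written as images under [c], but
    openness is a statement about inverse images under [coordV c]. *)
Lemma chart_imgE (U : set M) :
  c @` (dom c `&` U) = (c @` dom c) `&` coordV c @^-1` U.
Proof.
apply/seteqP; split=> [_ [x [dx Ux] <-]|_ [[x dx <-]]] /=.
  by split; [exists x|rewrite (chart_cancel cc)].
by rewrite (chart_cancel cc) // => Ux; exists x.
Qed.

Lemma chart_img_open_sub (U : set M) : open U -> open (c @` (dom c `&` U)).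
Proof.
move=> oU; rewrite chart_imgE; apply: open_setI_preimage => //.
  exact: chart_img_open cc.
exact: chartV_continuous cc.
Qed.

Lemma chartV_dom v : (c @` dom c) v -> dom c (coordV c v).
Proof. by move=> [x dx <-]; rewrite (chart_cancel cc). Qed.

Lemma chartVK v : (c @` dom c) v -> c (coordV c v) = v.
Proof. by move=> [x dx <-]; rewrite (chart_cancel cc). Qed.

End OneChart.

(** What manifolds and their products have in common. It is a property of a
    set of charts, so that the product of two manifolds needs no structure of
    its own. *)
Record atlas_axioms (M : topologicalType) (V : normedModType R)
    (A : set (chart M V)) : Prop := AtlasAxioms {
  atl_chart : forall c, A c -> is_chart c;
  atl_cover : forall x, exists c, A c /\ dom c x;
  atl_compat : forall c d, A c -> A d ->
    smooth_on (c @` (dom c `&` dom d)) (fun v => d (coordV c v));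
  atl_frame : finite_frame V }.

Lemma manifold_atlas n (M : manifoldType R n) : atlas_axioms (atlas M).
Proof.
split; [exact: atlas_chart|exact: atlas_cover|exact: atlas_compat|].
exact: finite_frame_mx.
Qed.

Lemma continuous_pair (T M N : topologicalType) (f : T -> M) (g : T -> N) x :
  {for x, continuous f} -> {for x, continuous g} ->
  {for x, continuous (fun y => (f y, g y))}.
Proof. by move=> cf cg; apply: cvg_pair. Qed.

Lemma prod_chartP (M N : topologicalType) (V W : normedModType R)
    (c : chart M V) (d : chart N W) :
  is_chart c -> is_chart d -> is_chart (prod_chart c d).
Proof.
have opX (P Q : topologicalType) (S : set P) (S' : set Q) : open S -> open S' ->
    open [set p : P * Q | S p.1 /\ S' p.2].
  move=> oS oS'; apply: openI; apply: open_comp => // x _.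
    exact: cvg_fst.
  exact: cvg_snd.
have img : prod_chart c d @` dom (prod_chart c d) =
    [set p : V * W | (c @` dom c) p.1 /\ (d @` dom d) p.2].
  apply/seteqP; split=> [_ [x [/= c1 d2] <-]|[v w] [/= [x cx <-] [y dy <-]]].
    by split; [exists x.1|exists x.2].
  by exists (x, y).
move=> cc dc; split.
- by apply: opX; [exact: chart_dom_open cc|exact: chart_dom_open dc].
- by rewrite img; apply: opX; [exact: chart_img_open cc|exact: chart_img_open dc].
- by move=> [x y] [/= dx dy]; rewrite (chart_cancel cc) // (chart_cancel dc).
- move=> [x y] [/= dx dy]; apply: (@continuous_pair (M * N)%type) => /=.
    apply: (@continuous_comp _ _ _ fst c); first exact: cvg_fst.
    exact: (chart_continuous cc).
  apply: (@continuous_comp _ _ _ snd d); first exact: cvg_snd.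
  exact: (chart_continuous dc).
- rewrite img => -[x y] [/= dx dy]; apply: (@continuous_pair (V * W)%type) => /=.
    apply: (@continuous_comp _ _ _ fst (coordV c)); first exact: cvg_fst.
    exact: (chartV_continuous cc).
  apply: (@continuous_comp _ _ _ snd (coordV d)); first exact: cvg_snd.
  exact: (chartV_continuous dc).
Qed.

Section Smooth.
Context {M N P : topologicalType} {V W X : normedModType R}.
Context {A : set (chart M V)} {B : set (chart N W)} {C : set (chart P X)}.
Hypotheses (hA : atlas_axioms A) (hB : atlas_axioms B) (hC : atlas_axioms C).

(** Locally, a chart [b] of the intermediate manifold around [f x] factors the
    coordinate expression of the composite. *)
Lemma smooth_comp (f : M -> N) (g : N -> P) :
  smooth_wrt A B f -> smooth_wrt B C g -> smooth_wrt A C (fun x => g (f x)).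
Proof.
move=> [cf sf] [cg sg]; split.
  by move=> x; apply: continuous_comp; [exact: cf|exact: cg].
move=> c e Ac Ce k.
have [cc ce] := (atl_chart hA Ac, atl_chart hC Ce).
apply: Ck_on_local => _ [x [dx edx] <-].
have [b [Bb bfx]] := atl_cover hB (f x); have cb := atl_chart hB Bb.
have od : open (g @^-1` dom e).
  by apply: open_comp => [y _|]; [exact: cg|exact: chart_dom_open ce].
pose O := f @^-1` dom b `&` f @^-1` (g @^-1` dom e).
have oO : open O.
  have /continuousP opf := cf.
  by apply: openI; apply: opf => //; exact: chart_dom_open cb.
exists (c @` (dom c `&` O)); first by exists x.
have oU : open (c @` (dom c `&` O)) by exact: chart_img_open_sub.
apply: (@Ck_on_eq _ _ _ _ _
  (fun v => (fun w => e (g (coordV b w))) (b (f (coordV c v))))) => //.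
  move=> v; rewrite chart_imgE // => -[dv [bv gv]].
  by rewrite (chart_cancel cb).
apply: (@Ck_on_comp _ _ _ _ _ _ (b @` (dom b `&` g @^-1` dom e))
  (fun v => b (f (coordV c v))) (fun w => e (g (coordV b w)))) => //.
- exact: atl_frame hB.
- exact: chart_img_open_sub.
- move=> v; rewrite chart_imgE // => -[dv [bv gv]].
  by exists (f (coordV c v)).
- apply: Ck_on_sub (sf _ _ Ac Bb k) => v; rewrite !chart_imgE //.
  by move=> -[dv [bv gv]].
- exact: sg.
Qed.

Lemma smooth_pair (f : M -> N) (g : M -> P) :
  smooth_wrt A B f -> smooth_wrt A C g ->
  smooth_wrt A (prod_atlas B C) (fun x => (f x, g x)).
Proof.
move=> [cf sf] [cg sg]; split.
  by move=> x; apply: continuous_pair; [exact: cf|exact: cg].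
move=> c _ Ac [b [e [Bb Ce ->]]] k.
have [cc ce] := (atl_chart hA Ac, atl_chart hC Ce).
have cb := atl_chart hB Bb.
apply: Ck_on_pair.
- apply: chart_img_open_sub => //.
  by apply: openI; apply: open_comp => [y _|]; try exact: cf; try exact: cg;
    exact: chart_dom_open.
- by apply: Ck_on_sub (sf _ _ Ac Bb k) => v; rewrite !chart_imgE // => -[dv []].
- by apply: Ck_on_sub (sg _ _ Ac Ce k) => v; rewrite !chart_imgE // => -[dv []].
Qed.

Lemma smooth_cst (y : N) : smooth_wrt A B (fun _ : M => y).
Proof.
split; first by move=> x; apply: cvg_cst.
by move=> c d Ac Bd k; apply: Ck_on_cst.
Qed.

Lemma smooth_id : smooth_wrt A A id.
Proof.
split; first by move=> x; apply: cvg_id.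
by move=> c d Ac Ad; apply: (atl_compat hA).
Qed.

End Smooth.

Section Product.
Context {M N : topologicalType} {V W : normedModType R}.
Context {A : set (chart M V)} {B : set (chart N W)}.
Hypotheses (hA : atlas_axioms A) (hB : atlas_axioms B).

Lemma smooth_fst : smooth_wrt (prod_atlas A B) A fst.
Proof.
split; first by move=> x; apply: cvg_fst.
move=> _ a [c [d [Ac Bd ->]]] Aa k.
have [[cc cd] ca] := (atl_chart hA Ac, atl_chart hB Bd, atl_chart hA Aa).
apply: (@Ck_on_comp _ _ _ _ _ _ (c @` (dom c `&` dom a)) fst
          (fun v => a (coordV c v))).
- exact: atl_frame hA.
- apply: chart_img_open_sub; first exact: prod_chartP.
  by apply: open_comp => [y _|]; [exact: cvg_fst|exact: chart_dom_open ca].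
- by apply: chart_img_open_sub => //; exact: chart_dom_open ca.
- by move=> _ [[x y] [[/= cx dy] ax] <-]; exists x.
- exact: Ck_on_fst.
- exact: (atl_compat hA Ac Aa).
Qed.

Lemma smooth_snd : smooth_wrt (prod_atlas A B) B snd.
Proof.
split; first by move=> x; apply: cvg_snd.
move=> _ a [c [d [Ac Bd ->]]] Ba k.
have [[cc cd] ca] := (atl_chart hA Ac, atl_chart hB Bd, atl_chart hB Ba).
apply: (@Ck_on_comp _ _ _ _ _ _ (d @` (dom d `&` dom a)) snd
          (fun v => a (coordV d v))).
- exact: atl_frame hB.
- apply: chart_img_open_sub; first exact: prod_chartP.
  by apply: open_comp => [y _|]; [exact: cvg_snd|exact: chart_dom_open ca].
- by apply: chart_img_open_sub => //; exact: chart_dom_open ca.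
- by move=> _ [[x y] [[/= cx dy] ax] <-]; exists y.
- exact: Ck_on_snd.
- exact: (atl_compat hB Bd Ba).
Qed.

Lemma prod_atlas_axioms : atlas_axioms (prod_atlas A B).
Proof.
have chP c : prod_atlas A B c -> is_chart c.
  by move=> [a [b [Aa Bb ->]]]; apply: prod_chartP; [exact: (atl_chart hA)|exact: (atl_chart hB)].
split => //.
- move=> [x y]; have [[a [Aa ax]] [b [Bb bx]]] := (atl_cover hA x, atl_cover hB y).
  by exists (prod_chart a b); split; [exists a, b|].
- move=> c _ Ac [a [b [Aa Bb ->]]] k; have cc := chP _ Ac.
  have [ca cb] := (atl_chart hA Aa, atl_chart hB Bb).
  apply: Ck_on_pair.
  + apply: chart_img_open_sub => //.
    exact: (chart_dom_open (prod_chartP ca cb)).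
  + apply: Ck_on_sub (smooth_fst.2 _ _ Ac Aa k) => v.
    by rewrite !chart_imgE // => -[dv []].
  + apply: Ck_on_sub (smooth_snd.2 _ _ Ac Bb k) => v.
    by rewrite !chart_imgE // => -[dv []].
- by apply: finite_frame_pair; [exact: atl_frame hA|exact: atl_frame hB].
Qed.

End Product.
End Charts.

(** * The quadratic remainder estimate *)

Section Quadratic.
Context {R : realType}.
Implicit Types V W : normedModType R.

Lemma diff_lipschitz_at V W (g : V -> W) (x : V) : differentiable g x ->
  exists2 C, 0 < C & \forall z \near x, `|g z - g x| <= C * `|z - x|.
Proof.
move=> dg; have [k k0 hk] := linear_lipschitz (diff_continuous dg).
exists (k + 1); first by rewrite addr_gt0.
have := diff_locally dg => /eqaddoP /(_ _ ltr01) H0.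
rewrite (near_shift 0 x) /= subr0; apply: filterS H0 => h /=.
rewrite !fctE /= mul1r => H; rewrite addrK.
rewrite -(subrK ('d g x h) (g _ - g x)) mulrDl mul1r addrC.
by apply: le_trans (ler_normD _ _) _; rewrite lerD // -addrA -opprD.
Qed.

(** Pointwise in the direction [v] this is differentiability of the map
    [z |-> 'd f z v] at [x0]; a finite frame makes the estimate uniform
    in [v]. *)
Lemma diff_lipschitz V W (f : V -> W) (U : set V) (x0 : V) :
  finite_frame V -> Ck_on 2 U f -> U x0 ->
  exists2 C, 0 < C & \forall z \near x0, forall v,
    `|'d f z v - 'd f x0 v| <= C * `|z - x0| * `|v|.
Proof.
move=> [I [e [l [cl fr]]]] [df Hf] Ux0.
have H1 i : exists p : R * R, [/\ 0 < p.1, 0 < p.2,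
    forall v, `|l i v| <= p.1 * `|v| &
    \forall z \near x0, `|'d f z (e i) - 'd f x0 (e i)| <= p.2 * `|z - x0|].
  have [k k0 hk] := linear_lipschitz (cl i).
  have [C C0 hC] := diff_lipschitz_at ((Hf (e i)).1 x0 Ux0).
  by exists (k, C).
have {H1} [p Hp] := choice H1.
exists (\sum_i (p i).1 * (p i).2 + 1).
  rewrite ltr_wpDl // sumr_ge0 // => i _.
  by have [p1 p2 _ _] := Hp i; rewrite mulr_ge0 // ltW.
have : \forall z \near x0, forall i, `|'d f z (e i) - 'd f x0 (e i)| <= (p i).2 * `|z - x0|.
  apply: filter_forall => i; by have [] := Hp i.
apply: filterS => z Hz v.
have E y : 'd f y v = \sum_i l i v *: 'd f y (e i).
  by rewrite {1}(fr v) linear_sum; apply: eq_bigr => i _; rewrite linearZ.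
rewrite !E -sumrB.
apply: le_trans (ler_norm_sum _ _ _) _.
apply: (@le_trans _ _ ((\sum_i (p i).1 * (p i).2) * `|z - x0| * `|v|)); last first.
  by rewrite ler_wpM2r // ler_wpM2r // lerDl.
rewrite !mulr_suml; apply: ler_sum => i _.
have [p1 p2 hl _] := Hp i.
rewrite -scalerBr normrZ.
have -> : (p i).1 * (p i).2 * `|z - x0| * `|v| =
    ((p i).1 * `|v|) * ((p i).2 * `|z - x0|) by ring.
by apply: ler_pM.
Qed.

Lemma mx_norm_le m n (A : 'M[R]_(m, n)) (c : R) :
  0 <= c -> (forall i j, `|A i j| <= c) -> `|A| <= c.
Proof.
move=> c0 Ac; rewrite /Num.Def.normr /= mx_normrE; by apply: bigmax_le => // -[i j] _.
Qed.

Lemma coord_le_norm m n (A : 'M[R]_(m, n)) i j : `|A i j| <= `|A|.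
Proof.
by rewrite [leRHS]/Num.Def.normr /= mx_normrE; apply/bigmax_geP; right; exists (i, j).
Qed.

Lemma line_diff V W (f : V -> W) (y w : V) (t : R) :
  differentiable f (y + t *: w) ->
  differentiable (fun s : R => f (y + s *: w)) t /\
  'd (fun s : R => f (y + s *: w)) t 1 = 'd f (y + t *: w) w.
Proof.
move=> df.
have [dl le] : differentiable (fun s : R => y + s *: w) t /\
    'd (fun s : R => y + s *: w) t 1 = w.
  have H : is_diff t (fun s : R => y + s *: w) (0 + ( *:%R^~ w)).
    exact: is_diffD.
  by split; [exact: ex_diff|rewrite diff_val /= add0r scale1r].
split; first exact: (differentiable_comp dl df).
have := congr1 (fun h : R -> W => h 1) (diff_comp dl df).
by rewrite /comp => ->; rewrite le.
Qed.

(** A C^2 map differs from its differential at [x0] by a map which is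
    [C * d]-Lipschitz on the ball of radius [d] around [x0]: the differential of
    the remainder at [z] is bounded by [C * `|z - x0|], and the mean value
    theorem, applied to each coordinate along a segment, turns this into a
    Lipschitz bound. *)
Lemma C2_quadratic V m (f : V -> 'rV[R]_m) (U : set V) (x0 : V) :
  finite_frame V -> open U -> Ck_on 2 U f -> U x0 ->
  exists C r : R, [/\ 0 < C, 0 < r & forall d x y, d < r ->
    `|x - x0| <= d -> `|y - x0| <= d ->
    `|f x - f y - 'd f x0 (x - y)| <= C * d * `|x - y|].
Proof.
move=> fV oU f2 Ux0; have [C C0 HC] := diff_lipschitz fV f2 Ux0.
have df := f2.1.
have : \forall z \near x0, U z /\ forall v,
    `|'d f z v - 'd f x0 v| <= C * `|z - x0| * `|v|.
  by apply: filterI HC; exact: open_nbhs_nbhs.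
move=> /nbhs_ballP[r /= r0 Hr].
exists C, r; split=> // d x y dr xd yd.
have d0 : 0 <= d := le_trans (normr_ge0 _) xd.
apply: mx_norm_le => [|i j]; first by rewrite !mulr_ge0 // ltW.
pose w := x - y; pose a := 'd f x0 w.
pose g t : R := (f (y + t *: w) - t *: a) i j.
pose g' t : R := ('d f (y + t *: w) w - a) i j.
(* Balls are convex, so the segment from [y] to [x] stays within [d] of [x0]. *)
have seg (t : R) : t \in `[0, 1] -> `|y + t *: w - x0| <= d.
  rewrite in_itv /= => /andP[t0 t1].
  have -> : y + t *: w - x0 = (1 - t) *: (y - x0) + t *: (x - x0).
    by rewrite /w scalerBl scale1r -[RHS]addrA [X in _ = _ + X]addrC -scalerBr opprB addrA subrK addrAC.
  apply: le_trans (ler_normD _ _) _; rewrite !normrZ.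
  rewrite (ger0_norm t0) ger0_norm ?subr_ge0 //.
  have -> : d = (1 - t) * d + t * d by ring.
  by rewrite lerD // ler_wpM2l // subr_ge0.
have inU (t : R) : t \in `[0, 1] -> U (y + t *: w) /\ forall v,
    `|'d f (y + t *: w) v - 'd f x0 v| <= C * `|y + t *: w - x0| * `|v|.
  move=> /seg H; apply: Hr; rewrite -ball_normE /= distrC.
  exact: le_lt_trans H dr.
pose L : {linear 'rV[R]_m -> R} := mx_coord i j.
have cL : continuous L by exact: mx_coord_continuous.
have dg (t : R) : t \in `[0, 1] -> is_derive t 1 g (g' t).
  move=> /inU[Ut _].
  have [dl le] := line_diff (df _ Ut).
  have H1 := is_diffB (differentiableP dl) (is_diff_scalel t a).
  have H3 := is_diff_comp H1 (differentiableP (linear_differentiable _ cL)).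
  have dgt : differentiable g t := @ex_diff _ _ _ _ _ _ _ H3.
  apply: DeriveDef; first exact: diff_derivable.
  rewrite (deriveE _ dgt).
  have -> : 'd g t 1 = _ := congr1 (fun h : R -> R => h 1) (@diff_val _ _ _ _ _ _ _ H3).
  by rewrite (diff_lin _ cL) /comp !fctE le scale1r.
have cg : {within `[0, 1], continuous g}.
  by apply: derivable_within_continuous => t /dg [].
have [t t01] := MVT_segment ler01 (fun t (tI : t \in `]0, 1[) => dg t (subset_itv_oo_cc tI)) cg.
have [_ Ht] := inU t t01.
have yw : y + 1 *: w = x by rewrite scale1r /w addrC subrK.
have -> : (f x - f y - 'd f x0 (x - y)) i j = g 1 - g 0.
  by rewrite /g yw scale1r !scale0r addr0 subr0 -/w -/a !mxE addrAC.
rewrite subr0 mulr1 => ->.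
apply: le_trans (coord_le_norm _ _ _) (le_trans (Ht w) _).
by rewrite ler_wpM2r // ler_wpM2l ?(ltW C0) // seg.
Qed.

End Quadratic.

(** * Group multiplication near the identity *)

Section ChartAt.
Context {R : realType} {n : nat} {M : manifoldType R n}.

Lemma chart_at_atlas (x : M) : atlas M (chart_at x).
Proof. by rewrite /chart_at; case: cid => c []. Qed.

Lemma chart_at_dom (x : M) : dom (chart_at x) x.
Proof. by rewrite /chart_at; case: cid => c []. Qed.

Lemma chart_atP (x : M) : is_chart (chart_at x).
Proof. exact: atlas_chart (chart_at_atlas x). Qed.

End ChartAt.

Section NearIdentity.
Context {R : realType} {m : nat} (H : lieGroupType R m).
Local Notation V := 'rV[R]_m.
Local Notation phi := (chart_at (1%g : H)).

(** The preferred chart at 1, translated so that 1 has coordinate 0. *)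
Definition ccoord (h : H) : V := phi h - phi 1%g.
Definition ccoordV (v : V) : H := coordV phi (v + phi 1%g).
Local Notation xi := ccoord.
Local Notation eta := ccoordV.

Lemma ccoord1 : xi 1%g = 0.
Proof. exact: subrr. Qed.

Lemma ccoordK h : dom phi h -> eta (xi h) = h.
Proof. by move=> dh; rewrite /eta /xi subrK (chart_cancel (chart_atP _)). Qed.

Lemma ccoord_inj h h' : dom phi h -> dom phi h' -> xi h = xi h' -> h = h'.
Proof. by move=> dh dh' E; rewrite -(ccoordK dh) E ccoordK. Qed.

Lemma ccoordV_nbhs : \forall v \near (0 : V),
  [/\ dom phi (eta v), xi (eta v) = v & {for v, continuous eta}].
Proof.
have ceta (v : V) : (phi @` dom phi) (v + phi 1%g) -> {for v, continuous eta}.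
  move=> Iv; apply: (@continuous_comp _ _ _ (fun w : V => w + phi 1%g) (coordV phi)).
    exact: differentiable_continuous (ex_diff (is_diff_def := is_diffD (is_diff_id v) (is_diff_cst (phi 1%g) v))).
  exact: (chartV_continuous (chart_atP _)).
have oI := chart_img_open (chart_atP (1%g : H)).
have I0 : (phi @` dom phi) (0 + phi 1%g) by rewrite add0r; exists 1%g => //; exact: chart_at_dom.
have : \forall v \near (0 : V), (phi @` dom phi) (v + phi 1%g).
  have : \forall w \near phi 1%g, (phi @` dom phi) w.
    by apply: open_nbhs_nbhs; split => //; rewrite add0r in I0.
  by rewrite (near_shift 0) subr0.
apply: filterS => v Iv; split.
- exact: (chartV_dom (chart_atP _)).
- by rewrite /xi /eta (chartVK (chart_atP _)) // addrK.
- exact: ceta.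
Qed.

Definition mul_coord (p : V * V) : V := phi (coordV phi p.1 * coordV phi p.2)%g.

Lemma mul_coord_smooth :
  exists U : set (V * V), [/\ open U, U (phi 1%g, phi 1%g),
    (forall p, U p -> dom phi (coordV phi p.1 * coordV phi p.2)%g) &
    smooth_on U mul_coord].
Proof.
have A1 := chart_at_atlas (1%g : H); have d1 := chart_at_dom (1%g : H).
have pc := prod_chartP (chart_atP (1%g : H)) (chart_atP (1%g : H)).
have [cm sm] := @mulg_smooth _ _ H.
pose c2 := prod_chart phi phi.
exists (c2 @` (dom c2 `&` (fun p : H * H => (p.1 * p.2)%g) @^-1` dom phi)); split.
- apply: chart_img_open_sub => //.
  by move/continuousP: cm; apply; exact: chart_dom_open (chart_atP _).
- by exists (1%g, 1%g) => //=; rewrite mulg1.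
- move=> _ [[x y] [[/= dx dy] dxy] <-] /=.
  by rewrite !(chart_cancel (chart_atP _)).
- by apply: (sm c2 phi) => //; exists phi, phi.
Qed.

(** Multiplication by 1 on either side is the identity, so both partial
    differentials of the product at [(1, 1)] are the identity. *)
Lemma diff_mul_coord v w : 'd mul_coord (phi 1%g, phi 1%g) (v, w) = v + w.
Proof.
have [U [oU U1 _ sU]] := mul_coord_smooth.
have dm := (sU 1%N).1 _ U1.
have [[dl El] [dr Er]] := diff_slice dm.
have dphi1 := chart_at_dom (1%g : H); have cP := chart_atP (1%g : H).
have nearI : \forall v \near phi 1%g, (phi @` dom phi) v.
  by apply: open_nbhs_nbhs; split; [exact: chart_img_open cP|exists 1%g].
have slice_id (f : V -> V) : (\forall v \near phi 1%g, f v = v) ->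
    forall v, 'd f (phi 1%g) v = v.
  move=> fid z; have [_ ->] := @diff_near_eq _ _ _ id f (phi 1%g)
    (filterS (fun _ => @esym _ _ _) fid) (ex_diff (is_diff_def := is_diff_id _)).
  by rewrite diff_val.
have -> : (v, w) = (v, 0) + (0, w) by congr pair; rewrite ?addr0 ?add0r.
apply: etrans (linearD ('d mul_coord (phi 1%g, phi 1%g)) (v, 0) (0, w)) _.
congr (_ + _).
  apply: etrans (esym (El v)) _; apply: slice_id.
  apply: filterS nearI => z Iz; rewrite /mul_coord /= (chart_cancel cP) //.
  by rewrite mulg1 (chartVK cP).
apply: etrans (esym (Er w)) _; apply: slice_id.
apply: filterS nearI => z Iz; rewrite /mul_coord /= (chart_cancel cP) //.
by rewrite mul1g (chartVK cP).
Qed.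

(** Up to a quadratic error, the group law near 1 is addition of coordinates:
    this is the quadratic remainder estimate for the product map, whose
    differential at [(1, 1)] is the sum. *)
Lemma mul_near1 : exists C r : R, [/\ 0 < C, 0 < r,
  (forall v : V, `|v| < r -> [/\ dom phi (eta v), xi (eta v) = v & {for v, continuous eta}]) &
  forall d a b a' b', d < r -> dom phi a -> dom phi b -> dom phi a' -> dom phi b' ->
    `|xi a| <= d -> `|xi b| <= d -> `|xi a'| <= d -> `|xi b'| <= d ->
    [/\ dom phi (a * b)%g, dom phi (a' * b')%g &
    `|xi (a * b)%g - xi (a' * b')%g - ((xi a - xi a') + (xi b - xi b'))| <=
      C * d * Num.max `|xi a - xi a'| `|xi b - xi b'|]].
Proof.
have [U [oU U1 Ud sU]] := mul_coord_smooth.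
have fV := @finite_frame_mx R 1 m.
have [C [r [C0 r0 HC]]] := C2_quadratic (finite_frame_pair fV fV) oU (sU 2%N) U1.
have /nbhs_ballP[r1 /= r10 Hr1] : nbhs (phi 1%g, phi 1%g) U by exact: open_nbhs_nbhs.
have /nbhs_ballP[r2 /= r20 Hr2] := ccoordV_nbhs.
exists C, (Num.min r (Num.min r1 r2)); split=> //.
- by rewrite !lt_min r0 r10.
- move=> v; rewrite !lt_min => /and3P[_ _ vr]; apply: Hr2.
  by rewrite -ball_normE /= sub0r normrN.
move=> d a b a' b'; rewrite !lt_min => /and3P[dr dr1 _] da db da' db' ad bd ad' bd'.
have cP := chart_atP (1%g : H).
have inU x y : dom phi x -> dom phi y -> `|xi x| <= d -> `|xi y| <= d ->
    dom phi (x * y)%g /\ xi (x * y)%g = mul_coord (phi x, phi y) - phi 1%g.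
  move=> dx dy xd yd.
  have Uxy : U (phi x, phi y).
    apply: Hr1; rewrite -ball_normE /= prod_normE /= gt_max.
    by rewrite distrC (le_lt_trans xd dr1) distrC (le_lt_trans yd dr1).
  have := Ud _ Uxy; rewrite /mul_coord /= !(chart_cancel cP) //.
have [dab ->] := inU _ _ da db ad bd.
have [dab' ->] := inU _ _ da' db' ad' bd'.
have subK (p q c : V) : p - c - (q - c) = p - q by rewrite opprB addrA subrK.
split=> //; rewrite /xi !subK.
have := HC d (phi a, phi b) (phi a', phi b') dr.
rewrite !prod_normE /= !ge_max !diff_mul_coord; apply.
  by rewrite ad bd.
by rewrite ad' bd'.
Qed.

(** * One-parameter subgroups *)

(** The curve [g] has velocity [u] at 0, with an error in [t ^ 2] instead of
    [o (t)]. The gain of a factor 4 when [t] is halved is what beats the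
    Lipschitz constant 3 of squaring. *)
Definition tangent_to (g : R -> H) (u : V) := exists C r : R,
  [/\ 0 < C, 0 < r & forall t, `|t| < r ->
    dom phi (g t) /\ `|xi (g t) - t *: u| <= C * t ^+ 2].

Lemma tangent_to_bound g u : tangent_to g u -> exists K r : R,
  [/\ 0 < K, 0 < r & forall t, `|t| < r ->
    [/\ dom phi (g t), `|xi (g t) - t *: u| <= K * t ^+ 2 & `|xi (g t)| <= K * `|t|]].
Proof.
move=> [C [r [C0 r0 Hg]]].
exists (C + `|u|), (Num.min r 1); split.
- by rewrite ltr_wpDr.
- by rewrite lt_min r0 ltr01.
move=> t; rewrite lt_min => /andP[tr t1]; have [dg gt] := Hg t tr.
split=> //; first by apply: le_trans gt _; rewrite ler_wpM2r ?sqr_ge0 // lerDl.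
rewrite -(subrK (t *: u) (xi _)); apply: le_trans (ler_normD _ _) _.
rewrite mulrDl normrZ [`|t| * _]mulrC lerD2r; apply: le_trans gt _.
by rewrite ler_wpM2l ?(ltW C0) // -real_normK ?num_real // expr2 ler_piMr // ltW.
Qed.

Lemma tangent_toM g1 g2 u1 u2 : tangent_to g1 u1 -> tangent_to g2 u2 ->
  tangent_to (fun t => g1 t * g2 t)%g (u1 + u2).
Proof.
move=> /tangent_to_bound[K1 [r1 [K10 r10 H1]]] /tangent_to_bound[K2 [r2 [K20 r20 H2]]].
have [C [r [C0 r0 _ HM]]] := mul_near1.
pose K := K1 + K2; have K0 : 0 < K by rewrite addr_gt0.
exists (C * K ^+ 2 + K), (Num.min (Num.min r1 r2) (r / K)); split.
- by rewrite addr_gt0 // mulr_gt0 // exprn_gt0.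
- by rewrite !lt_min r10 r20 divr_gt0.
move=> t; rewrite !lt_min => /andP[/andP[tr1 tr2] trK].
have [d1 E1 B1] := H1 t tr1; have [d2 E2 B2] := H2 t tr2.
have dr : K * `|t| < r by rewrite mulrC -ltr_pdivlMr.
have B1' : `|xi (g1 t)| <= K * `|t|.
  by apply: le_trans B1 _; rewrite ler_wpM2r // lerDl ltW.
have B2' : `|xi (g2 t)| <= K * `|t|.
  by apply: le_trans B2 _; rewrite ler_wpM2r // lerDr ltW.
have dH1 := chart_at_dom (1%g : H).
have Kt0 : 0 <= K * `|t| by rewrite mulr_ge0 // ltW.
have X1 : `|xi 1%g| <= K * `|t| by rewrite ccoord1 normr0.
have [d12 _] := HM _ _ _ _ _ dr d1 d2 dH1 dH1 B1' B2' X1 X1.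
rewrite mulg1 ccoord1 !subr0 => HE; split=> //.
have -> : xi (g1 t * g2 t)%g - t *: (u1 + u2) =
    (xi (g1 t * g2 t)%g - (xi (g1 t) + xi (g2 t))) +
    ((xi (g1 t) - t *: u1) + (xi (g2 t) - t *: u2)).
  by apply/matrixP => i j; rewrite !mxE; ring.
apply: le_trans (ler_normD _ _) _; rewrite mulrDl lerD //.
  apply: le_trans HE _.
  have -> : C * K ^+ 2 * t ^+ 2 = C * (K * `|t|) * (K * `|t|).
    by rewrite -[t ^+ 2]real_normK ?num_real //; ring.
  by apply: ler_wpM2l; [rewrite mulr_ge0 // ltW|rewrite ge_max B1' B2'].
apply: le_trans (ler_normD _ _) _; rewrite mulrDl; exact: lerD.
Qed.

Lemma inv_near1 : exists K r : R, [/\ 0 < K, 0 < r &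
  forall h, dom phi h -> `|xi h| < r ->
    dom phi (h^-1)%g /\ `|xi (h^-1)%g| <= K * `|xi h|].
Proof.
have A1 := chart_at_atlas (1%g : H); have d1 := chart_at_dom (1%g : H).
have cP := chart_atP (1%g : H).
have [ci si] := @invg_smooth _ _ H.
pose S := phi @` (dom phi `&` (fun h : H => h^-1)%g @^-1` dom phi).
have oS : open S.
  apply: chart_img_open_sub => //.
  by move/continuousP: ci; apply; exact: chart_dom_open cP.
have S1 : S (phi 1%g) by exists 1%g => //; split=> //=; rewrite invg1.
have [K K0 HK] := diff_lipschitz_at ((si _ _ A1 A1 1%N).1 _ S1).
have : \forall v \near phi 1%g, S v /\
  `|phi ((coordV phi v)^-1)%g - phi ((coordV phi (phi 1%g))^-1)%g| <= K * `|v - phi 1%g|.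
  by apply: filterI HK; exact: open_nbhs_nbhs.
move=> /nbhs_ballP[r /= r0 Hr]; exists K, r; split=> // h dh hr.
have [|[x [dx dxV] E]] := Hr (phi h); first by rewrite -ball_normE /= distrC.
rewrite !(chart_cancel cP) // invg1 => HE; split=> //.
have <- : x = h by rewrite -(chart_cancel cP dx) E (chart_cancel cP).
exact: dxV.
Qed.

(** The product estimate, applied to [g t] and its inverse, bounds the sum of
    their coordinates quadratically. *)
Lemma tangent_toV g u : tangent_to g u -> tangent_to (fun t => (g t)^-1)%g (- u).
Proof.
move=> /tangent_to_bound[K1 [r1 [K10 r10 H1]]].
have [K2 [r2 [K20 r20 H2]]] := inv_near1.
have [C [r [C0 r0 _ HM]]] := mul_near1.
pose K := K1 + K2 * K1; have K0 : 0 < K by rewrite addr_gt0 // mulr_gt0.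
exists (C * K ^+ 2 + K1), (Num.min r1 (Num.min (r2 / K1) (r / K))); split.
- by rewrite addr_gt0 // mulr_gt0 // exprn_gt0.
- by rewrite !lt_min r10 !divr_gt0.
move=> t; rewrite !lt_min => /and3P[tr1 tr2 trK].
have [d1 E1 B1] := H1 t tr1.
have dr : K * `|t| < r by rewrite mulrC -ltr_pdivlMr.
have [|d2 B2] := H2 _ d1.
  by apply: le_lt_trans B1 _; rewrite mulrC -ltr_pdivlMr.
split=> //.
have B1' : `|xi (g t)| <= K * `|t|.
  by apply: le_trans B1 _; rewrite ler_wpM2r // lerDl ltW // mulr_gt0.
have B2' : `|xi (g t)^-1%g| <= K * `|t|.
  apply: le_trans B2 _; rewrite mulrDl -mulrA; apply: ler_wpDl.
    by rewrite mulr_ge0 // ltW.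
  by rewrite ler_wpM2l // ltW.
have dH1 := chart_at_dom (1%g : H).
have Kt0 : 0 <= K * `|t| by rewrite mulr_ge0 // ltW.
have X1 : `|xi 1%g| <= K * `|t| by rewrite ccoord1 normr0.
have [_ _] := HM _ _ _ _ _ dr d1 d2 dH1 dH1 B1' B2' X1 X1.
rewrite mulgV mulg1 ccoord1 !subr0 sub0r normrN => HE.
have -> : xi (g t)^-1%g - t *: - u =
    (xi (g t) + xi (g t)^-1%g) - (xi (g t) - t *: u).
  by apply/matrixP => i j; rewrite !mxE; ring.
apply: le_trans (ler_normB _ _) _; rewrite mulrDl lerD //.
apply: le_trans HE _.
have -> : C * K ^+ 2 * t ^+ 2 = C * (K * `|t|) * (K * `|t|).
  by rewrite -[t ^+ 2]real_normK ?num_real //; ring.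
by apply: ler_wpM2l; [rewrite mulr_ge0 // ltW|rewrite ge_max B1' B2'].
Qed.

Lemma tangent_to_scale g u s : tangent_to g u ->
  tangent_to (fun t => g (s * t)) (s *: u).
Proof.
move=> [C [r [C0 r0 Hg]]].
exists (C * s ^+ 2 + C), (r / (`|s| + 1)).
have s1 : 0 < `|s| + 1 by rewrite ltr_wpDl.
split.
- by rewrite ltr_wpDl // mulr_ge0 ?sqr_ge0 // ltW.
- by rewrite divr_gt0.
move=> t tr; have [|dg gt] := Hg (s * t).
  rewrite normrM; apply: le_lt_trans (_ : `|s| * `|t| <= (`|s| + 1) * `|t|) _.
    by rewrite ler_wpM2r // lerDl.
  by rewrite mulrC -ltr_pdivlMr.
split=> //; rewrite scalerA [t * s]mulrC; apply: le_trans gt _.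
by rewrite exprMn mulrDl mulrA lerDl mulr_ge0 ?sqr_ge0 // ltW.
Qed.

Lemma tangent_to1 : tangent_to (fun=> 1%g) 0.
Proof.
exists 1, 1; split=> // t _; rewrite ccoord1 scaler0 subr0 normr0 mul1r sqr_ge0.
by split=> //; exact: chart_at_dom.
Qed.

Lemma tangent_toX g u k : tangent_to g u ->
  tangent_to (fun t => g t ^+ k)%g (k%:R *: u).
Proof.
move=> gu; elim: k => [|k IH].
  rewrite scale0r; have -> : (fun t => g t ^+ 0)%g = (fun=> 1%g) by apply/funext => t; rewrite expg0.
  exact: tangent_to1.
have -> : (fun t => g t ^+ k.+1)%g = (fun t => g t * g t ^+ k)%g.
  by apply/funext => t; rewrite expgS.
by rewrite mulrS scalerDl scale1r; apply: tangent_toM.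
Qed.

(** The differential of squaring at 1 is multiplication by 2, so squaring is
    3-Lipschitz near 1. *)
Lemma square_near1 : exists C r : R, [/\ 0 < C, 0 < r,
  (forall v : V, `|v| < r -> [/\ dom phi (eta v), xi (eta v) = v & {for v, continuous eta}]) ,
  (forall a, dom phi a -> `|xi a| < r ->
    dom phi (a ^+ 2)%g /\ `|xi (a ^+ 2)%g - 2 *: xi a| <= C * `|xi a| ^+ 2) &
  forall a a', dom phi a -> dom phi a' -> `|xi a| < r -> `|xi a'| < r ->
    `|xi (a ^+ 2)%g - xi (a' ^+ 2)%g| <= 3 * `|xi a - xi a'|].
Proof.
have [C [r [C0 r0 Hv HM]]] := mul_near1.
have d1 := chart_at_dom (1%g : H).
exists C, (Num.min r C^-1); split=> //.
- by rewrite lt_min r0 invr_gt0.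
- by move=> v; rewrite lt_min => /andP[vr _]; apply: Hv.
- move=> a da; rewrite lt_min => /andP[ar _].
  have X1 : `|xi 1%g| <= `|xi a| by rewrite ccoord1 normr0.
  have [daa _] := HM _ _ _ _ _ ar da da d1 d1 (lexx _) (lexx _) X1 X1.
  rewrite mulg1 ccoord1 !subr0 maxxx expgS expg1 scaler_nat mulr2n => E.
  by split=> //; rewrite expr2 mulrA.
- move=> a a' da da'; rewrite !lt_min => /andP[ar aC] /andP[ar' aC'].
  pose d := Num.max `|xi a| `|xi a'|.
  have dr : d < r by rewrite gt_max ar ar'.
  have dC : C * d <= 1 by rewrite -ler_pdivlMl // mulr1 ge_max !ltW.
  have ad : `|xi a| <= d by rewrite le_max lexx.
  have ad' : `|xi a'| <= d by rewrite le_max lexx orbT.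
  have [_ _] := HM _ _ _ _ _ dr da da da' da' ad ad ad' ad'.
  rewrite maxxx !(expgS _ 1) !expg1 => E.
  rewrite -(subrK (xi a - xi a' + (xi a - xi a')) (xi _ - _)).
  apply: le_trans (ler_normD _ _) _.
  have -> : 3 * `|xi a - xi a'| = 1 * `|xi a - xi a'| + (`|xi a - xi a'| + `|xi a - xi a'|) by ring.
  rewrite lerD // ?ler_normD //; apply: le_trans E _; exact: ler_wpM2r.
Qed.

Lemma le_geometric (x M q : R) : 0 <= q < 1 ->
  (forall k, x <= q ^+ k * M) -> x <= 0.
Proof.
move=> /andP[q0 q1] Hx.
have qc : (fun k => q ^+ k * M) @ \oo --> 0 * M.
  by apply: cvgMl; apply: cvg_expr; rewrite ger0_norm.
rewrite -(mul0r M) -(cvg_lim (@Rhausdorff R) qc).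
by apply: limr_ge; [apply/cvg_ex; exists (0 * M)|exact: nearW].
Qed.

Definition doubling (g : R -> H) := forall t, g (2 * t) = (g t ^+ 2)%g.

Lemma doublingX g k t : doubling g -> g t = (g (t / 2 ^+ k)%R ^+ (2 ^ k))%g.
Proof.
move=> dg; elim: k t => [|k IH] t; first by rewrite expr0 divr1 expg1.
rewrite [LHS]IH expnS expgnA -dg; congr (g _ ^+ _)%g.
by rewrite exprS; field; rewrite expf_neq0 // pnatr_eq0.
Qed.

Lemma half_pow_lt (t r : R) : 0 < r -> exists k, `|t / 2 ^+ k| < r.
Proof.
move=> r0.
have qc : (fun k => (2^-1 : R) ^+ k * `|t|) @ \oo --> 0 * `|t|.
  by apply: cvgMl; apply: cvg_expr; rewrite ger0_norm // invf_lt1 // ltr1n.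
move: qc; rewrite mul0r => /cvgr0Pnorm_lt /(_ r r0) [k _ /(_ k (leqnn k)) /=].
by move=> Hk; exists k; rewrite -exprVn mulrC normrM -[`|t|]normr_id -normrM.
Qed.

(** Going from [t] to [t / 2] multiplies the distance between the curves by at
    most 3 on the way back, and divides the bound [(K1 + K2) * t ^+ 2] by 4.
    Equality for small [t] propagates to all [t] by repeated squaring. *)
Lemma doubling_unique g1 g2 u : doubling g1 -> doubling g2 ->
  tangent_to g1 u -> tangent_to g2 u -> g1 =1 g2.
Proof.
move=> D1 D2 /tangent_to_bound[K1 [r1 [K10 r10 H1]]] /tangent_to_bound[K2 [r2 [K20 r20 H2]]].
have [C [r [C0 r0 _ _ HS]]] := square_near1.
pose r' := Num.min (Num.min r1 r2) (Num.min (r / K1) (r / K2)).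
have r'0 : 0 < r' by rewrite !lt_min r10 r20 !divr_gt0.
have small t : `|t| < r' -> [/\ dom phi (g1 t), dom phi (g2 t) & forall k,
    `|xi (g1 t) - xi (g2 t)| <= (3 / 4) ^+ k * ((K1 + K2) * t ^+ 2)].
  move=> tr'; split.
  - by move: tr'; rewrite !lt_min => /andP[/andP[/H1[]]].
  - by move: tr'; rewrite !lt_min => /andP[/andP[_ /H2[]]].
  move=> k; elim: k t tr' => [|k IH] t.
    rewrite !lt_min => /andP[/andP[/H1[_ E1 _] /H2[_ E2 _]] _].
    rewrite expr0 mul1r -(subrK (t *: u) (xi (g1 t))) -addrA mulrDl.
    by apply: le_trans (ler_normD _ _) _; rewrite lerD // distrC.
  move=> tr; have tr' : `|t / 2| < r'.
    rewrite normf_div (ger0_norm (ler0n _ _)); apply: le_lt_trans tr.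
    by rewrite ler_pdivrMr // ler_peMr // ler1n.
  have /IH Hk := tr'; move: tr'; rewrite !lt_min => /andP[/andP[t1 t2] /andP[t3 t4]].
  have [d1 _ B1] := H1 _ t1; have [d2 _ B2] := H2 _ t2.
  have tE : t = 2 * (t / 2) by rewrite mulrC divfK.
  rewrite {1 2}tE D1 D2; apply: le_trans (HS _ _ d1 d2 _ _) _.
  - by apply: le_lt_trans B1 _; rewrite mulrC -ltr_pdivlMr.
  - by apply: le_lt_trans B2 _; rewrite mulrC -ltr_pdivlMr.
  have -> : (3 / 4) ^+ k.+1 * ((K1 + K2) * t ^+ 2) =
    3 * ((3 / 4) ^+ k * ((K1 + K2) * (t / 2) ^+ 2)) by rewrite exprS; field.
  by rewrite ler_wpM2l.
move=> t; have [k tk] := half_pow_lt t r'0.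
rewrite (doublingX k t D1) (doublingX k t D2); congr (_ ^+ _)%g.
have [d1 d2 Hk] := small _ tk; apply: ccoord_inj => //.
apply/eqP; rewrite -subr_eq0 -normr_le0.
by apply: le_geometric Hk; lra.
Qed.

(** Cauchy criterion, with the tails bounded by those of a geometric
    series. *)
Lemma geometric_cvg (x : nat -> V) (M q : R) : 0 <= q < 1 ->
  (forall k, `|x k.+1 - x k| <= M * q ^+ k) -> cvg (x @ \oo).
Proof.
move=> /andP[q0 q1] Hx; have q1' : 0 < 1 - q by rewrite subr_gt0.
have M0 : 0 <= M by have := Hx 0%N; rewrite expr0 mulr1; apply: le_trans.
have tail n k : `|x (n + k)%N - x n| <= M * q ^+ n / (1 - q).
  elim: k n => [|k IH] n.
    by rewrite addn0 subrr normr0 divr_ge0 ?mulr_ge0 ?exprn_ge0 // ltW.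
  rewrite -(subrK (x n.+1) (x _)) -addrA addnS -addSn.
  apply: le_trans (ler_normD _ _) _.
  have -> : M * q ^+ n / (1 - q) = M * q ^+ n.+1 / (1 - q) + M * q ^+ n.
    by rewrite exprS; field; rewrite lt0r_neq0.
  by rewrite lerD.
apply: cauchy_cvg; apply: cauchy_exP => e e0.
have qc : (fun k => q ^+ k * (M / (1 - q))) @ \oo --> 0 * (M / (1 - q)).
  by apply: cvgMl; apply: cvg_expr; rewrite ger0_norm.
move: qc; rewrite mul0r => /cvgr0Pnorm_lt /(_ e e0) [n _ /(_ n (leqnn n)) /= Hn].
exists (x n); exists n => // k /= nk; rewrite -ball_normE /= distrC -(subnKC nk).
apply: le_lt_trans (tail _ _) _; apply: le_lt_trans Hn.
by rewrite mulrAC [X in X <= _]mulrC ler_norm.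
Qed.

Lemma norm_lim_le (x : nat -> V) (l c : V) (b : R) :
  x @ \oo --> l -> (forall k, `|x k - c| <= b) -> `|l - c| <= b.
Proof.
move=> /cvgrPdist_le xl xb; apply/ler_addgt0Pr => e /xl[k _ /(_ k (leqnn k)) /= Hk].
rewrite -(subrK (x k) l) -addrA addrC.
by apply: le_trans (ler_normD _ _) _; exact: lerD.
Qed.

(** The [2 ^ k]-th power of the element with coordinate [t *: u / 2 ^ k],
    organised so that the curve of index [k + 1] at [t] is the square of the
    curve of index [k] at [t / 2]. *)
Fixpoint power_curve (u : V) (k : nat) (t : R) : H :=
  if k is k'.+1 then (power_curve u k' (t / 2)%R ^+ 2)%g else eta (t *: u).

(** The limit of [power_curve u k]. The bound [C1 * t ^ 2] on the deviation
    from [t *: u] is stable under the recursion: squaring multiplies the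
    deviation at [t / 2] by at most 3, which uses up three quarters of the bound,
    and the quadratic error made by squaring the element of coordinate
    [t / 2 *: u] fits in the last quarter. *)
Lemma local_curve (u : V) : exists (g : R -> H) (C r : R), [/\ 0 < C, 0 < r,
  (forall t, `|t| < r -> dom phi (g t) /\ `|xi (g t) - t *: u| <= C * t ^+ 2),
  (forall t, `|t| < r -> g t = (g (t / 2)%R ^+ 2)%g) &
  (forall t : R, `|t| < r -> {for t, continuous g})].
Proof.
have [C [rho [C0 rho0 Heta Hsq1 Hsq]]] := square_near1.
pose K := `|u|; have K0 : 0 <= K := normr_ge0 u.
have [C1 [C10 C1le]] : exists C1, 0 < C1 /\ C * K ^+ 2 <= C1.
  exists (C * K ^+ 2 + 1); split; last by rewrite lerDl.
  by rewrite ltr_wpDl // mulr_ge0 ?exprn_ge0 // ltW.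
pose r := Num.min 1 (rho / (K + C1)).
have KC0 : 0 < K + C1 by rewrite ltr_wpDl.
have r0 : 0 < r by rewrite lt_min ltr01 divr_gt0.
pose F := power_curve u.
have t1 (t : R) : `|t| < r -> t ^+ 2 <= `|t|.
  rewrite lt_min => /andP[/ltW t1 _].
  by rewrite -real_normK ?num_real // expr2 ler_piMr.
have tK (t : R) : `|t| < r -> K * `|t| + C1 * t ^+ 2 < rho.
  move=> tr; apply: (@le_lt_trans _ _ ((K + C1) * `|t|)).
    by rewrite mulrDl lerD2l ler_wpM2l ?(ltW C10) // t1.
  by move: tr; rewrite lt_min => /andP[_]; rewrite ltr_pdivlMr // mulrC.
have near_rho (t : R) (v : V) : `|t| < r -> `|v - t *: u| <= C1 * t ^+ 2 -> `|v| < rho.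
  move=> tr vt; apply: le_lt_trans (tK _ tr); rewrite -(subrK (t *: u) v) addrC.
  by apply: le_trans (ler_normD _ _) _; rewrite normrZ [`|t| * _]mulrC lerD2l.
have half (t : R) : `|t| < r -> `|t / 2| < r.
  move=> tr; rewrite normf_div (ger0_norm (ler0n _ _)); apply: le_lt_trans tr.
  by rewrite ler_pdivrMr // ler_peMr // ler1n.
have tuP (t : R) : `|t| < r -> `|t *: u| < rho.
  by move=> tr; apply: near_rho tr _; rewrite subrr normr0 mulr_ge0 ?sqr_ge0 // ltW.
have FP k (t : R) : `|t| < r -> dom phi (F k t) /\ `|xi (F k t) - t *: u| <= C1 * t ^+ 2.
  elim: k t => [|k IH] t tr /=.
    have [d E _] := Heta _ (tuP _ tr).
    by rewrite /F /= E subrr normr0 mulr_ge0 ?sqr_ge0 // ltW.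
  have [da Ea] := IH _ (half _ tr); set a := F k (t / 2) in da Ea *.
  have [db Eb _] := Heta _ (tuP _ (half _ tr)); set b := eta _ in db Eb.
  have ar := near_rho _ _ (half _ tr) Ea.
  have br : `|xi b| < rho by rewrite Eb tuP // half.
  have [daa _] := Hsq1 _ da ar; split=> //.
  have [_ Ebb] := Hsq1 _ db br; have Eab := Hsq _ _ da db ar br.
  rewrite -/(F k) -/a -(subrK (xi (b ^+ 2)%g) (xi (a ^+ 2)%g)) -addrA.
  apply: le_trans (ler_normD _ _) _.
  have -> : t *: u = 2 *: xi b by rewrite Eb scalerA mulrC divfK.
  have -> : C1 * t ^+ 2 = 3 * (C1 * (t / 2) ^+ 2) + C1 * (t / 2) ^+ 2 by field.
  apply: lerD; first by apply: le_trans Eab _; rewrite ler_wpM2l // Eb.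
  apply: le_trans Ebb _; rewrite Eb normrZ exprMn real_normK ?num_real //.
  have -> : C * ((t / 2) ^+ 2 * K ^+ 2) = (C * K ^+ 2) * (t / 2) ^+ 2 by ring.
  by rewrite ler_wpM2r ?sqr_ge0.
have Frho k (t : R) : `|t| < r -> `|xi (F k t)| < rho.
  by move=> tr; apply: near_rho tr (FP k t tr).2.
have Fstep k (t : R) : `|t| < r -> `|xi (F k.+1 t) - xi (F k t)| <= C1 * t ^+ 2 * (3 / 4) ^+ k.
  elim: k t => [|k IH] t tr.
    have [_ E _] := Heta _ (tuP _ tr).
    by rewrite expr0 mulr1 [F 0%N t]/= E; exact: (FP 1%N t tr).2.
  have tr2 := half _ tr.
  apply: le_trans (Hsq _ _ (FP k.+1 _ tr2).1 (FP k _ tr2).1 (Frho _ _ tr2) (Frho _ _ tr2)) _.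
  have -> : C1 * t ^+ 2 * (3 / 4) ^+ k.+1 = 3 * (C1 * (t / 2) ^+ 2 * (3 / 4) ^+ k).
    by rewrite [_ ^+ k.+1]exprS; field.
  by rewrite ler_wpM2l // IH.
have q01 : 0 <= (3 / 4 : R) < 1 by lra.
pose E t := lim ((fun k => xi (F k t)) @ \oo).
have FE (t : R) : `|t| < r -> (fun k => xi (F k t)) @ \oo --> E t.
  by move=> tr; apply: (geometric_cvg q01) => k; exact: Fstep.
have Et (t : R) : `|t| < r -> `|E t - t *: u| <= C1 * t ^+ 2.
  by move=> tr; apply: norm_lim_le (FE t tr) _ => k; exact: (FP k t tr).2.
have Erho (t : R) : `|t| < r -> `|E t| < rho.
  by move=> tr; apply: near_rho tr (Et _ tr).
have gE (t : R) : `|t| < r -> [/\ dom phi (eta (E t)), xi (eta (E t)) = E t &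
    {for E t, continuous eta}] by move=> /Erho/Heta.
have gD (t : R) : `|t| < r -> eta (E t) = (eta (E (t / 2)%R) ^+ 2)%g.
  move=> tr; have tr2 := half _ tr.
  have [d1 x1 _] := gE _ tr; have [d2 x2 _] := gE _ tr2.
  have x2r : `|xi (eta (E (t / 2)))| < rho by rewrite x2 Erho.
  have [d22 _] := Hsq1 _ d2 x2r; apply: ccoord_inj => //; rewrite x1.
  have c1 : (fun k => xi (F k.+1 t)) @ \oo --> E t.
    by have := FE t tr; rewrite -(cvg_shiftS (fun k => xi (F k t))).
  apply: (cvg_unique (@norm_hausdorff _ _) c1).
  apply/cvgrPdist_le => e e0.
  have /cvgrPdist_le /(_ (e / 3)) := FE _ tr2.
  rewrite divr_gt0 // => /(_ isT); apply: filterS => k Hk.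
  apply: le_trans (Hsq _ _ d2 (FP k _ tr2).1 x2r (Frho _ _ tr2)) _.
  by rewrite x2 mulrC -ler_pdivlMr.
(* Convergence is uniform, which gives continuity of the limit below. *)
have Etail k (t : R) : `|t| < r -> `|E t - xi (F k t)| <= (3 / 4) ^+ k * (C1 * t ^+ 2).
  elim: k t => [|k IH] t tr.
    have [_ x0 _] := Heta _ (tuP _ tr).
    by rewrite expr0 mul1r [F 0%N t]/= x0; exact: Et.
  have tr2 := half _ tr; have [d1 x1 _] := gE _ tr; have [d2 x2 _] := gE _ tr2.
  rewrite -x1 gD //.
  apply: le_trans (Hsq _ _ d2 (FP k _ tr2).1 _ (Frho _ _ tr2)) _; first by rewrite x2 Erho.
  have -> : (3 / 4) ^+ k.+1 * (C1 * t ^+ 2) = 3 * ((3 / 4) ^+ k * (C1 * (t / 2) ^+ 2)).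
    by rewrite [_ ^+ k.+1]exprS; field.
  by rewrite ler_wpM2l // x2 IH.
have Flip k (s t : R) : `|s| < r -> `|t| < r ->
    `|xi (F k s) - xi (F k t)| <= (3 / 2) ^+ k * K * `|s - t|.
  elim: k s t => [|k IH] s t sr tr.
    have [_ xs _] := Heta _ (tuP _ sr); have [_ xt _] := Heta _ (tuP _ tr).
    by rewrite /F /= xs xt -scalerBl normrZ expr0 mul1r mulrC.
  have [sr2 tr2] := (half _ sr, half _ tr).
  apply: le_trans (Hsq _ _ (FP k _ sr2).1 (FP k _ tr2).1 (Frho _ _ sr2) (Frho _ _ tr2)) _.
  have -> : (3 / 2) ^+ k.+1 * K * `|s - t| = 3 * ((3 / 2) ^+ k * K * `|s / 2 - t / 2|).
    by rewrite -mulrBl normrM [`|2^-1|]ger0_norm // [_ ^+ k.+1]exprS; field.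
  by rewrite ler_wpM2l // IH.
have Ec (t : R) : `|t| < r -> {for t, continuous E}.
  move=> tr; apply/cvgrPdist_le => e e0.
  have qc : (fun k => (3 / 4) ^+ k * C1) @ \oo --> 0 * C1.
    by apply: cvgMl; apply: cvg_expr; rewrite ger0_norm; lra.
  have e3 : 0 < e / 3 by rewrite divr_gt0.
  move: qc; rewrite mul0r => /cvgr0Pnorm_lt /(_ _ e3) [k _ /(_ k (leqnn k)) /= Hk].
  have tail (s : R) : `|s| < r -> `|E s - xi (F k s)| <= e / 3.
    move=> sr; apply: le_trans (Etail k s sr) _; apply: le_trans (ltW Hk).
    apply: le_trans _ (ler_norm _); rewrite ler_wpM2l ?exprn_ge0 //.
    rewrite ler_piMr // ?(ltW C10) //; apply: le_trans (t1 _ sr) _.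
    by move: sr; rewrite lt_min => /andP[/ltW].
  (* The added 1 keeps the Lipschitz constant nonzero. *)
  pose L := (3 / 2) ^+ k * K + 1.
  have L0 : 0 < L by rewrite ltr_wpDl // mulr_ge0 ?exprn_ge0 //; lra.
  have n1 : \forall s \near t, `|s| < r.
    have : {for t, continuous (fun s : R => `|s|)} by exact: norm_continuous.
    by move/cvgr_lt; apply.
  have n2 : \forall s \near t, `|t - s| <= e / 3 / L.
    by apply/nbhs_ballP; exists (e / 3 / L); rewrite /= ?divr_gt0 // => s /ltW.
  near=> s.
  have sr : `|s| < r by near: s.
  have ts : `|t - s| <= e / 3 / L by near: s.
  have -> : E t - E s = (E t - xi (F k t)) + (xi (F k t) - xi (F k s)) - (E s - xi (F k s)).
    by apply/matrixP => i j; rewrite !mxE; ring.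
  have -> : e = e / 3 + e / 3 + e / 3 by field.
  apply: le_trans (ler_normB _ _) _; apply: lerD (tail _ sr).
  apply: le_trans (ler_normD _ _) _; apply: lerD (tail _ tr) _.
  apply: le_trans (Flip k _ _ tr sr) _.
  apply: (@le_trans _ _ (L * `|t - s|)); first by rewrite ler_wpM2r // lerDl.
  by rewrite mulrC -ler_pdivlMr.
exists (fun t => eta (E t)), C1, r; split=> // [t tr|t tr].
  by have [d -> _] := gE t tr; split=> //; exact: Et.
by have [_ _ ?] := gE t tr; apply: continuous_comp => //; exact: Ec.
Unshelve. all: by end_near. Qed.

Lemma expg_continuous k : continuous (fun x : H => x ^+ k)%g.
Proof.
elim: k => [|k IH] x.
  have -> : (fun x : H => x ^+ 0)%g = (fun=> 1%g) by apply/funext => y; rewrite expg0.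
  exact: cvg_cst.
have -> : (fun x : H => x ^+ k.+1)%g = (fun x : H => x * x ^+ k)%g.
  by apply/funext => y; rewrite expgS.
apply: (@continuous_comp _ _ _ (fun y : H => (y, (y ^+ k)%g)) (fun p : H * H => (p.1 * p.2)%g)).
  by apply: continuous_pair; [exact: cvg_id|exact: IH].
exact: (@mulg_smooth _ _ H).1.
Qed.

(** The curve is extended by [g t = g0 (t / 2 ^ k) ^ (2 ^ k)] for any [k] such
    that [t / 2 ^ k] is in the domain of the local curve; doubling makes this
    independent of [k]. *)
Lemma global_curve (u : V) : exists g : R -> H,
  [/\ doubling g, tangent_to g u & continuous g].
Proof.
have [g0 [C [r [C0 r0 tg dg cg]]]] := local_curve u.
have [n nP] := choice (fun t => half_pow_lt t r0).
have half (t : R) : `|t| < r -> `|t / 2| < r.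
  move=> tr; rewrite normf_div (ger0_norm (ler0n _ _)); apply: le_lt_trans tr.
  by rewrite ler_pdivrMr // ler_peMr // ler1n.
have divS (t : R) k : t / 2 ^+ k.+1 = t / 2 ^+ k / 2.
  by rewrite exprSr invfM mulrA.
have small t k j : `|t / 2 ^+ k| < r -> `|t / 2 ^+ (k + j)| < r.
  by move=> tk; elim: j => [|j IH]; rewrite ?addn0 // addnS divS half.
have stab t k j : `|t / 2 ^+ k| < r ->
    (g0 (t / 2 ^+ k)%R ^+ (2 ^ k) = g0 (t / 2 ^+ (k + j))%R ^+ (2 ^ (k + j)))%g.
  move=> tk; elim: j => [|j ->]; first by rewrite addn0.
  by rewrite addnS dg ?small // divS expnS expgnA.
pose g t := (g0 (t / 2 ^+ n t)%R ^+ (2 ^ n t))%g.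
have gE t k : `|t / 2 ^+ k| < r -> g t = (g0 (t / 2 ^+ k)%R ^+ (2 ^ k))%g.
  by move=> tk; rewrite /g (stab _ _ k (nP t)) (stab _ _ (n t) tk) addnC.
exists g; split.
- move=> t; have tk := nP t; rewrite (gE t _ tk) -expgnA -expnSr.
  have E : 2 * t / 2 ^+ (n t).+1 = t / 2 ^+ n t.
    by rewrite exprS; field; rewrite expf_neq0 // pnatr_eq0.
  by rewrite (gE _ (n t).+1) E.
- exists C, r; split=> // t tr; rewrite (gE t 0%N) expr0 divr1 //.
  by rewrite expg1; exact: tg.
- move=> t; have tk := nP t; set k := n t in tk.
  have ck : {for t, continuous (fun s : R => s / 2 ^+ k)}.
    by apply: cvgMl; exact: cvg_id.
  suff : {for t, continuous g} by [].
  apply: (@continuous_near_eq R H (fun s : R => g0 (s / 2 ^+ k)%R ^+ (2 ^ k))%g g t).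
    have : {for t, continuous (fun s : R => `|s / 2 ^+ k|)}.
      by apply: continuous_comp => //; exact: norm_continuous.
    by move/cvgr_lt => /(_ _ tk); apply: filterS => s /gE ->.
  apply: (@continuous_comp R H H (fun s : R => g0 (s / 2 ^+ k)) (fun x : H => x ^+ (2 ^ k))%g).
    by apply: (@continuous_comp R R H (fun s : R => s / 2 ^+ k) g0) => //; exact: cg.
  exact: expg_continuous.
Qed.

Lemma continuous_eq_rat (T : topologicalType) (f1 f2 : R -> T) :
  hausdorff_space T -> continuous f1 -> continuous f2 ->
  (forall q : rat, f1 (ratr q) = f2 (ratr q)) -> f1 =1 f2.
Proof.
move=> hT c1 c2 E x; apply/eqP; apply: contrapT => /negP ne.
rewrite open_hausdorff in hT.
have [[A B] /= [Ax Bx] [oA oB /eqP AB0]] := hT _ _ ne.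
move/continuousP in c1; move/continuousP in c2.
have oAB : open (f1 @^-1` A `&` f2 @^-1` B) by apply: openI; [exact: c1|exact: c2].
have [|y [[Ay By] [q _ qy]]] := @dense_rat R _ _ oAB.
  by exists x; split; apply/set_mem.
have : (A `&` B) (f1 y) by split=> //=; rewrite -qy E qy.
by rewrite AB0.
Qed.

Section OneParam.
Variables (g : R -> H) (u : V).
Hypotheses (dg : doubling g) (tg : tangent_to g u) (cg : continuous g).

(** Both sides satisfy the doubling equation and have velocity [k%:R *: u]. *)
Lemma doubling_natmul k t : g (k%:R * t) = (g t ^+ k)%g.
Proof.
apply: (@doubling_unique (fun t => g (k%:R * t)) (fun t => g t ^+ k)%g (k%:R *: u)).
- by move=> s; rewrite mulrCA dg.
- by move=> s; rewrite dg -!expgnA mulnC.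
- exact: tangent_to_scale.
- exact: tangent_toX.
Qed.

Lemma doubling_opp t : g (- t) = (g t)^-1%g.
Proof.
rewrite -[- t]mulN1r.
apply: (@doubling_unique (fun t => g (-1 * t)) (fun t => (g t)^-1)%g (- u)).
- by move=> s; rewrite mulrCA dg.
- by move=> s; rewrite dg expVgn.
- by have := tangent_to_scale (-1) tg; rewrite scaleN1r.
- exact: tangent_toV.
Qed.

(** Values at rational multiples of one time are powers, or inverses of
    powers, of a common element; the general case follows by density. *)
Lemma doubling_commute s t : commute (g s) (g t).
Proof.
suff H0 th : commute (g s) (g (s * th)).
  have [->|s0] := eqVneq s 0; last by rewrite -(divfK s0 t) mulrC.
  have -> : g 0 = 1%g by rewrite -(mul0r (0 : R)) (doubling_natmul 0) expg0.
  exact/commute_sym/commute1.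
have cgs : continuous (fun th => g (s * th)).
  move=> x; apply: (@continuous_comp _ _ _ (fun th : R => s * th) g); last exact: cg.
  by apply: cvgMr; exact: cvg_id.
have cm := (@mulg_smooth _ _ H).1.
(* Commutation of [g s] with [g (s * th)] is a closed condition on [th]. *)
apply: (@continuous_eq_rat H (fun th => g s * g (s * th)%R)%g (fun th => g (s * th)%R * g s)%g).
- exact: manifold_hausdorff.
- move=> x; apply: (@continuous_comp _ _ _ (fun th => (g s, g (s * th))) (fun p : H * H => (p.1 * p.2)%g)).
    by apply: continuous_pair; [exact: cvg_cst|exact: cgs].
  exact: cm.
- move=> x; apply: (@continuous_comp _ _ _ (fun th => (g (s * th), g s)) (fun p : H * H => (p.1 * p.2)%g)).
    by apply: continuous_pair; [exact: cgs|exact: cvg_cst].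
  exact: cm.
move=> q; pose w := s / (denq q)%:~R.
have d0 : (denq q)%:~R != 0 :> R by rewrite intr_eq0 denq_neq0.
have -> : g s = (g w ^+ `|denq q|)%g.
  by rewrite -doubling_natmul natr_absz gtr0_norm ?denq_gt0 // mulrC divfK.
have -> : s * ratr q = (numq q)%:~R * w by rewrite /w /ratr mulrCA mulrA mulrAC.
case: (numq q) => n; first by rewrite doubling_natmul; exact: commuteX2.
rewrite NegzE mulrNz mulNr doubling_opp; apply: commuteV.
by rewrite doubling_natmul; exact: commuteX2.
Qed.

(** Since the values of [g] commute, [x |-> g (s * x) * g (t * x)] satisfies the
    doubling equation, and it has velocity [(s + t) *: u]. *)
Lemma doubling_morph s t : g (s + t) = (g s * g t)%g.
Proof.
have C a b : commute (g a) (g b) := doubling_commute a b.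
have -> : (g s * g t)%g = (g (s * 1)%R * g (t * 1)%R)%g by rewrite !mulr1.
rewrite -[s + t]mulr1.
apply: (@doubling_unique (fun x => g ((s + t) * x))
  (fun x => g (s * x)%R * g (t * x)%R)%g ((s + t) *: u)).
- by move=> x; rewrite mulrCA dg.
- by move=> x; rewrite (mulrCA s) (mulrCA t) !dg expgMn.
- exact: tangent_to_scale.
- by rewrite scalerDl; apply: tangent_toM; exact: tangent_to_scale.
Qed.

End OneParam.

Lemma tangent_to_0 g u : tangent_to g u -> g 0 = 1%g.
Proof.
move=> [C [r [C0 r0 /(_ 0)]]]; rewrite normr0 => /(_ r0)[d0].
rewrite scale0r subr0 expr0n mulr0 normr_le0 => /eqP E.
by apply: ccoord_inj; rewrite ?ccoord1 //; exact: chart_at_dom.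
Qed.

Lemma tangent_to_diff g u : tangent_to g u ->
  is_diff (0 : R) (fun t => phi (g t)) ( *:%R^~ u : R -> V).
Proof.
move=> tg; have g0 := tangent_to_0 tg; move: tg => [C [r [C0 r0 Hg]]].
have su := is_diff_scalel (0 : R) u.
have dE : 'd ( *:%R^~ u : R -> V) (0 : R) = ( *:%R^~ u) :> (R -> V) := diff_val.
have key : (fun t => phi (g t)) \o shift (0 : R) =
    cst (phi (g 0)) + 'd ( *:%R^~ u : R -> V) (0 : R) +o_ 0 id.
  rewrite dE; apply/eqaddoP => e e0.
  have H1 : \forall h \near (0 : R), `|h| < Num.min r (e / C).
    apply/nbhs_ballP; exists (Num.min r (e / C)); first by rewrite /= lt_min r0 divr_gt0.
    by move=> h; rewrite -ball_normE /= sub0r normrN.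
  apply: filterS H1 => h; rewrite lt_min => /andP[hr hC].
  have [_ Eh] := Hg h hr.
  rewrite !fctE /= addr0 g0 opprD addrA; apply: le_trans Eh _.
  rewrite -real_normK ?num_real // expr2 mulrA ler_wpM2r // mulrC.
  by rewrite -ler_pdivlMr // ltW.
have cd : continuous ('d ( *:%R^~ u : R -> V) (0 : R)).
  by apply: diff_continuous; exact: (@ex_diff _ _ _ _ _ _ _ su).
by have := is_diff_remainder cd key; rewrite dE.
Qed.

(** For a smooth curve the error is quadratic by the remainder estimate
    between [t] and 0. *)
Lemma smooth_tangent_to g : smooth_wrt (@vec_atlas R^o) (atlas H) (g : R^o -> H) ->
  g 0 = 1%g -> tangent_to g (velocity g 0).
Proof.
move=> [cg sg] g0.
have vE : velocity g 0 = derive1 (fun s => phi (g s)) 0 by rewrite /velocity g0.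
rewrite vE.
have := sg (Chart setT id id) phi erefl (chart_at_atlas _).
rewrite /= setTI image_id => sf.
have cP := chart_atP (1%g : H); have d1 := chart_at_dom (1%g : H).
have oS : open (g @^-1` dom phi).
  by move/continuousP: cg; apply; exact: chart_dom_open cP.
have S0 : (g @^-1` dom phi) (0 : R) by rewrite /= g0.
have [C [r [C0 r0 HC]]] := C2_quadratic (@finite_frameR R) oS (sf 2%N) S0.
have /nbhs_ballP[r1 /= r10 Hr1] : nbhs (0 : R) (g @^-1` dom phi).
  exact: open_nbhs_nbhs.
have df := (sf 1%N).1 _ S0.
exists C, (Num.min r r1); split; rewrite ?lt_min ?r0 //.
move=> t; rewrite lt_min => /andP[tr tr1]; split.
  by apply: Hr1; rewrite -ball_normE /= sub0r normrN.
have := HC `|t| t 0 tr; rewrite !subr0 normr0 => /(_ (lexx _) (normr_ge0 _)).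
rewrite derive1E' // g0.
have -> : 'd (fun v : R => phi (g v)) 0 t = t *: 'd (fun v : R => phi (g v)) 0 1.
  by rewrite -linearZ /= [t *: 1]mulr1.
by rewrite -mulrA -expr2 real_normK ?num_real.
Qed.

Section HomSmooth.
Variables (g : R -> H) (u : V).
Hypotheses (mg : forall s t, g (s + t) = (g s * g t)%g) (tg : tangent_to g u)
  (cg : continuous g).

(** The product in coordinates, the left factor being read in an arbitrary
    chart [d] and the right factor in the chart at 1. *)
Definition left_mul_coord (d : chart H V) (p : V * V) : V :=
  d (coordV d p.1 * coordV phi p.2)%g.

Definition left_mul_dom (d : chart H V) : set (V * V) :=
  prod_chart d phi @` (dom (prod_chart d phi) `&`
     (fun p : H * H => (p.1 * p.2)%g) @^-1` dom d).

Lemma left_mul_coord_smooth d : atlas H d ->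
  [/\ open (left_mul_dom d), smooth_on (left_mul_dom d) (left_mul_coord d) &
    forall h, dom d h -> left_mul_dom d (d h, phi 1%g)].
Proof.
move=> Ad; have cd : is_chart d := atlas_chart _ Ad; have cP := chart_atP (1%g : H).
have [cm sm] := @mulg_smooth _ _ H; split.
- apply: chart_img_open_sub; first exact: prod_chartP.
  by move/continuousP: cm; apply; exact: chart_dom_open cd.
- apply: (sm (prod_chart d phi) d) => //.
  by exists d, phi; split=> //; exact: chart_at_atlas.
- by move=> h dh; exists (h, 1%g) => //=; rewrite mulg1; split=> //; split=> //; exact: chart_at_dom.
Qed.

(** The left-invariant vector field with value [u] at 1, read in the
    chart [d]. *)
Definition left_field (d : chart H V) (y : V) : V :=
  'd (left_mul_coord d) (y, phi 1%g) (0, u).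

(** The homomorphism [g] is an integral curve of the left-invariant field:
    near [t], [g s = g t * g (s - t)], and the right factor has velocity [u] at
    [s = t]. *)
Lemma hom_diff d t : atlas H d -> dom d (g t) ->
  is_diff t (fun s => d (g s)) ( *:%R^~ (left_field d (d (g t))) : R -> V).
Proof.
move=> Ad dt; have cd : is_chart d := atlas_chart _ Ad; have cP := chart_atP (1%g : H).
have [oU sU U1] := left_mul_coord_smooth Ad.
have g0 := tangent_to_0 tg.
have [_ [dL EL]] := diff_slice ((sU 1%N).1 _ (U1 _ dt)).
have sh : is_diff t (fun s : R => s - t) id.
  by have := is_diffB (is_diff_id t) (is_diff_cst t t); rewrite subr0.
have d1 : is_diff t (fun s : R => phi (g (s - t))) ( *:%R^~ u : R -> V).
  have tg' : is_diff (t - t) (fun s => phi (g s)) ( *:%R^~ u : R -> V).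
    by rewrite subrr; exact: tangent_to_diff.
  exact: (@is_diff_comp _ R R V (fun s : R => s - t) id (fun s => phi (g s)) ( *:%R^~ u) t sh tg').
have phi0 : phi (g (t - t)) = phi 1%g by rewrite subrr g0.
have d2 : is_diff (phi (g (t - t))) (fun w => left_mul_coord d (d (g t), w))
   ('d (fun w => left_mul_coord d (d (g t), w)) (phi 1%g)).
  by rewrite phi0; exact: differentiableP.
have d3 := is_diff_comp d1 d2.
have near_t : \forall s \near t, dom phi (g (s - t)).
  have c : {for t, continuous (fun s : R => g (s - t))}.
    apply: (@continuous_comp R R H (fun s : R => s - t) g); last exact: cg.
    exact: differentiable_continuous ex_diff.
  apply: c; rewrite subrr g0; apply: open_nbhs_nbhs; split.
    exact: chart_dom_open cP.
  exact: chart_at_dom.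
have eqn : \forall s \near t, left_mul_coord d (d (g t), phi (g (s - t))) = d (g s).
  apply: filterS near_t => s ds.
  rewrite /left_mul_coord /= (chart_cancel cd) // (chart_cancel cP) //.
  by rewrite -mg addrC subrK.
have := is_diff_near_eq eqn d3; congr (is_diff t _ _).
apply/funext => s /=; rewrite linearZ /= /left_field -EL //.
Qed.

Lemma left_field_Ck d k : atlas H d -> Ck_on k (d @` dom d) (left_field d).
Proof.
move=> Ad; have cd : is_chart d := atlas_chart _ Ad.
have [oU sU U1] := left_mul_coord_smooth Ad.
have fV := @finite_frame_mx R 1 m.
have oI := chart_img_open cd.
apply: (@Ck_on_comp _ k _ _ _ (d @` dom d) (left_mul_dom d)
  (fun y => (y, phi 1%g)) (fun p => 'd (left_mul_coord d) p (0, u))) => //.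
- exact: finite_frame_pair.
- by move=> _ [h dh <-]; exact: U1.
- apply: Ck_on_pair => //; last exact: Ck_on_cst.
  by apply: (@Ck_on_linear _ k _ _ _ idfun) => x; apply: cvg_id.
- exact: (sU k.+1).2.
Qed.

(** If [g] is of class C^k then so is its derivative [left_field d (d (g t))],
    so [g] is of class C^(k+1). *)
Lemma hom_smooth : smooth_wrt (@vec_atlas R^o) (atlas H) (g : R^o -> H).
Proof.
split; first exact: cg.
move=> _ d -> Ad; rewrite /= setTI image_id.
have cd : is_chart d := atlas_chart _ Ad.
have oS : open (g @^-1` dom d).
  by move/continuousP: cg; apply; exact: chart_dom_open cd.
have dg t : dom d (g t) -> differentiable (fun s : R => d (g s)) t.
  by move=> dt; have dd := hom_diff Ad dt; exact: (@ex_diff _ _ _ _ _ _ _ dd).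
elim=> [|k IH].
  by move=> t dt; apply: differentiable_continuous; exact: dg.
split=> [t|v]; first exact: dg.
apply: (@Ck_on_eq R k R V (g @^-1` dom d) (fun t => v *: left_field d (d (g t)))) => //.
  move=> t dt; have dd := hom_diff Ad dt.
  by rewrite (@diff_val _ _ _ _ _ _ _ dd).
apply: (@Ck_on_scale R k R V _ (fun=> v)) => //; first exact: Ck_on_cst.
apply: (@Ck_on_comp _ k R V V _ (d @` dom d) (fun t => d (g t)) (left_field d)) => //.
- exact: finite_frame_mx.
- exact: chart_img_open cd.
- exact: left_field_Ck.
Qed.

End HomSmooth.

Lemma hom_velocity g u : tangent_to g u -> velocity g 0 = u.
Proof.
move=> tg; rewrite /velocity (tangent_to_0 tg).
have dd := tangent_to_diff tg.
rewrite derive1E'; last exact: (@ex_diff _ _ _ _ _ _ _ dd).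
by rewrite (@diff_val _ _ _ _ _ _ _ dd) scale1r.
Qed.

Lemma one_param_doubling (g : R -> H) (u : lie_alg H) : one_param_subgroup u g -> doubling g /\ tangent_to g u.
Proof.
move=> [sg mg vg]; split; first by move=> t; rewrite mulr_natl mulr2n mg.
rewrite -vg; apply: smooth_tangent_to => //.
have := mg 0 0; rewrite addr0 => E; apply/esym.
by apply: (@mulgI _ (g 0)); rewrite mulg1.
Qed.

Lemma one_param_unique (g1 g2 : R -> H) (u : lie_alg H) :
  one_param_subgroup u g1 -> one_param_subgroup u g2 -> g1 = g2.
Proof.
move=> /one_param_doubling[d1 t1] /one_param_doubling[d2 t2].
by apply/funext; exact: doubling_unique t1 t2.
Qed.

Lemma one_param_exists (u : lie_alg H) : exists g, one_param_subgroup u g.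
Proof.
have [g [dg tg cg]] := global_curve u; exists g.
have mg := doubling_morph dg tg cg.
by split=> //; [exact: hom_smooth tg cg|exact: (hom_velocity tg)].
Qed.

(** The curve [s |-> g (t * s)] is the one-parameter subgroup with velocity
    [t *: u], and its value at 1 is [g t]. *)
Lemma lie_expE (g : R -> H) (u : lie_alg H) t :
  one_param_subgroup u g -> lie_exp (t *: u) = g t.
Proof.
move=> og; have [dg tg] := one_param_doubling og; have [sg mg vg] := og.
have ot : one_param_subgroup (t *: u : lie_alg H) (fun s => g (t * s)).
  have tt := tangent_to_scale t tg.
  have mt s1 s2 : g (t * (s1 + s2)) = (g (t * s1)%R * g (t * s2)%R)%g by rewrite mulrDr mg.
  have ct : continuous (fun s => g (t * s)).
    move=> x; apply: (@continuous_comp R R H (fun s : R => t * s) g).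
      by apply: cvgMr; exact: cvg_id.
    exact: sg.1.
  by split=> //; [exact: hom_smooth tt ct|exact: (hom_velocity tt)].
rewrite /lie_exp; case: xgetP => [x _ [g' og' ->]|/(_ (g t))].
  by rewrite (one_param_unique og' ot) mulr1.
by case; exists (fun s => g (t * s)) => //; rewrite mulr1.
Qed.

End NearIdentity.

(** * The adjoint action and the twisted representation *)

Section DiffAt1.
Context {R : realType} {m : nat} (H : lieGroupType R m).
Local Notation V := 'rV[R]_m.
Local Notation phi := (chart_at (1%g : H)).

(** For [f] fixing 1 this is the tangent map of [f] at 1, as an endomorphism of
    the Lie algebra. *)
Definition diff1 (f : H -> H) : {linear V -> V} :=
  'd (fun v => phi (f (coordV phi v))) (phi 1%g).

Lemma smooth_mul (M : topologicalType) (W : normedModType R) (A : set (chart M W))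
    (f g : M -> H) :
  atlas_axioms A -> smooth_wrt A (atlas H) f -> smooth_wrt A (atlas H) g ->
  smooth_wrt A (atlas H) (fun x => f x * g x)%g.
Proof.
move=> hA sf sg; have hH := manifold_atlas H.
have hHH := prod_atlas_axioms hH hH.
exact: (smooth_comp hA hHH hH (smooth_pair hA hH hH sf sg) mulg_smooth).
Qed.

Lemma smooth_inv (M : topologicalType) (W : normedModType R) (A : set (chart M W))
    (f : M -> H) :
  atlas_axioms A -> smooth_wrt A (atlas H) f ->
  smooth_wrt A (atlas H) (fun x => (f x)^-1)%g.
Proof.
move=> hA sf; have hH := manifold_atlas H.
exact: (smooth_comp hA hH hH sf invg_smooth).
Qed.

Lemma smooth_conj (h : H) : smooth_wrt (atlas H) (atlas H) (fun x => h * x * h^-1)%g.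
Proof.
have hH := manifold_atlas H.
by do 2?apply: smooth_mul => //; do ?exact: smooth_cst; exact: smooth_id.
Qed.

Lemma diff1_is_diff f : smooth_wrt (atlas H) (atlas H) f -> f 1%g = 1%g ->
  is_diff (phi 1%g) (fun v => phi (f (coordV phi v))) (diff1 f).
Proof.
move=> [cf sf] f1; apply: differentiableP.
apply: ((sf _ _ (chart_at_atlas _) (chart_at_atlas _) 1%N).1).
by exists 1%g => //; split; rewrite /= ?f1; exact: chart_at_dom.
Qed.

Lemma diff1_comp f g u :
  smooth_wrt (atlas H) (atlas H) f -> smooth_wrt (atlas H) (atlas H) g ->
  f 1%g = 1%g -> g 1%g = 1%g -> diff1 (fun x => g (f x)) u = diff1 g (diff1 f u).
Proof.
move=> sf sg f1 g1; have cP := chart_atP (1%g : H); have d1 := chart_at_dom (1%g : H).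
have df := diff1_is_diff sf f1; have dg := diff1_is_diff sg g1.
have phi1 : phi (f (coordV phi (phi 1%g))) = phi 1%g by rewrite (chart_cancel cP) // f1.
rewrite -phi1 in dg.
have dgf := is_diff_comp df dg.
have oS : open (phi @` (dom phi `&` f @^-1` dom phi)).
  apply: chart_img_open_sub => //.
  by move/continuousP: (sf.1); apply; exact: chart_dom_open cP.
have eqn : \forall v \near phi 1%g,
    phi (g (coordV phi (phi (f (coordV phi v))))) = phi (g (f (coordV phi v))).
  apply: filterS (open_nbhs_nbhs (conj oS _)).
    by move=> v; rewrite chart_imgE // => -[_ /= dv]; rewrite (chart_cancel cP).
  by exists 1%g => //; split; rewrite //= f1.
have d2 := is_diff_near_eq eqn dgf.
exact: (congr1 (fun h : V -> V => h u) (@diff_val _ _ _ _ _ _ _ d2)).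
Qed.

Lemma diff1_id u : diff1 id u = u.
Proof.
have cP := chart_atP (1%g : H).
have eqn : \forall v \near phi 1%g, id v = phi (coordV phi v).
  apply: filterS (open_nbhs_nbhs (conj (chart_img_open cP) _)).
    by move=> v Iv; rewrite (chartVK cP).
  by exists 1%g => //; exact: chart_at_dom.
have d2 := is_diff_near_eq eqn (is_diff_id _).
exact: (congr1 (fun h : V -> V => h u) (@diff_val _ _ _ _ _ _ _ d2)).
Qed.

(** The curve differentiated in the definition of [Ad] is the image under
    conjugation of the one-parameter subgroup with velocity [u]. *)
Lemma Ad_diff1 (h : H) (u : lie_alg H) : Ad h u = diff1 (fun x => h * x * h^-1)%g u.
Proof.
have [g og] := one_param_exists u; have [dg tg] := one_param_doubling og.
have g0 := tangent_to_0 tg; have cP := chart_atP (1%g : H).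
set c := (fun x => h * x * h^-1)%g.
have c1 : c 1%g = 1%g by rewrite /c mulg1 mulgV.
have dc : is_diff (phi (g 0)) (fun v => phi (c (coordV phi v))) (diff1 c).
  by rewrite g0; exact: diff1_is_diff (smooth_conj h) c1.
rewrite /Ad; have -> : (fun t : R => h * lie_exp (t *: u) * h^-1)%g = (fun t => c (g t)).
  by apply/funext => t; rewrite (lie_expE t og).
rewrite /velocity g0 c1.
have dphi := tangent_to_diff tg.
have d2 := is_diff_comp dphi dc.
have eqn : \forall t \near (0 : R), phi (c (coordV phi (phi (g t)))) = phi (c (g t)).
  move: tg => [C [r [C0 r0 Hg]]].
  apply/nbhs_ballP; exists r => // t; rewrite -ball_normE /= sub0r normrN => tr.
  by rewrite (chart_cancel cP) //; exact: (Hg t tr).1.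
have d3 := is_diff_near_eq eqn d2.
rewrite derive1E'; last exact: (@ex_diff _ _ _ _ _ _ _ d3).
by rewrite (@diff_val _ _ _ _ _ _ _ d3) /= scale1r.
Qed.

End DiffAt1.

(** Continuity comes for free from the C^0 part of smoothness in charts. *)
Lemma smooth_wrt_vec (R : realType) (M : topologicalType) (V W : normedModType R)
    (A : set (chart M V)) (f : M -> W) : atlas_axioms A ->
  (forall c, A c -> smooth_on (c @` dom c) (fun v => f (coordV c v))) ->
  smooth_wrt A (@vec_atlas W) f.
Proof.
move=> hA Hf; split=> [x|c _ Ac ->]; last first.
  by rewrite /= preimage_setT setIT; exact: Hf.
have [c [Ac cx]] := atl_cover hA x; have cc := atl_chart hA Ac.
suff : {for x, continuous f} by [].
apply: (@continuous_near_eq _ _ (fun y => f (coordV c (c y)))).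
  apply: filterS (open_nbhs_nbhs (conj (chart_dom_open cc) cx)) => y cy.
  by rewrite (chart_cancel cc).
apply: (@continuous_comp M V W c (fun v => f (coordV c v))).
  exact: (chart_continuous cc).
by apply: (Hf c Ac 0%N); exists x.
Qed.

Section Twisted.
Context {R : realType} {n m : nat} (G : lieGroupType R n) (H : lieGroupType R m).
Variables (Theta : G -> H -> H) (D : G -> H).
Hypotheses (hTheta : lie_action Theta) (hD : crossed_hom Theta D).
Local Notation V := 'rV[R]_m.
Local Notation phi := (chart_at (1%g : H)).

Definition twisted (a : G) (x : H) : H := (D a * Theta a x * (D a)^-1)%g.

Lemma action1 a : Theta a 1%g = 1%g.
Proof.
have := lie_autM (lie_act_aut hTheta a) 1%g 1%g; rewrite mulg1 => E.
by apply/esym/(@mulgI _ (Theta a 1%g)); rewrite mulg1.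
Qed.

Lemma actionV a x : Theta a (x^-1)%g = ((Theta a x)^-1)%g.
Proof.
apply: (@mulgI _ (Theta a x)).
by rewrite -(lie_autM (lie_act_aut hTheta a)) !mulgV action1.
Qed.

Lemma crossed1 : D 1%g = 1%g.
Proof.
have := crossedM hD 1%g 1%g; rewrite mulg1 (lie_act1 hTheta) => E.
by apply/esym/(@mulgI _ (D 1%g)); rewrite mulg1.
Qed.

Lemma twisted1 a : twisted a 1%g = 1%g.
Proof. by rewrite /twisted action1 mulg1 mulgV. Qed.

(** The identity [D (a * b) = D a * Theta a (D b)] moves the conjugation by
    [D b] past [Theta a]. *)
Lemma twistedM a b x : twisted (a * b)%g x = twisted a (twisted b x).
Proof.
have M := lie_autM (lie_act_aut hTheta a).
by rewrite /twisted (crossedM hD) (lie_actM hTheta) !M actionV invgM !mulgA.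
Qed.

Lemma twisted_1 x : twisted 1%g x = x.
Proof. by rewrite /twisted crossed1 (lie_act1 hTheta) mul1g invg1 mulg1. Qed.

Lemma twisted_smooth :
  smooth_wrt (prod_atlas (atlas G) (atlas H)) (atlas H) (fun p => twisted p.1 p.2).
Proof.
have [hG hH] := (manifold_atlas G, manifold_atlas H).
have hGH := prod_atlas_axioms hG hH.
have sD := smooth_comp hGH hG hH (smooth_fst hG hH) (crossed_smooth hD).
apply: smooth_mul => //; last exact: smooth_inv.
by apply: smooth_mul => //; exact: lie_act_smooth.
Qed.

Lemma twisted_smooth1 a : smooth_wrt (atlas H) (atlas H) (twisted a).
Proof.
have hH := manifold_atlas H.
apply: smooth_mul => //; last exact: smooth_cst.
apply: smooth_mul => //; first exact: smooth_cst.
exact: (lie_aut_smooth (lie_act_aut hTheta a)).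
Qed.

Lemma tilde_diff1 a u : tilde_action Theta a u = diff1 (Theta a) u.
Proof. by rewrite /tilde_action /tangent_map action1. Qed.

Lemma Ad_tilde a (u : lie_alg H) :
  Ad (D a) (tilde_action Theta a u) = diff1 (twisted a) u.
Proof.
apply: etrans (Ad_diff1 _ _) _; rewrite tilde_diff1; apply/esym.
apply: (diff1_comp (f := Theta a) (g := fun x => D a * x * (D a)^-1)%g).
- exact: (lie_aut_smooth (lie_act_aut hTheta a)).
- exact: smooth_conj.
- exact: action1.
- by rewrite mulg1 mulgV.
Qed.

Lemma diff1_twistedM a b u :
  diff1 (twisted (a * b)%g) u = diff1 (twisted a) (diff1 (twisted b) u).
Proof.
have -> : twisted (a * b)%g = (fun x => twisted a (twisted b x)).
  by apply/funext => x; exact: twistedM.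
by apply: diff1_comp; try exact: twisted_smooth1; exact: twisted1.
Qed.

Lemma diff1_twisted1 u : diff1 (twisted 1%g) u = u.
Proof.
have -> : twisted 1%g = id by apply/funext => x; exact: twisted_1.
exact: diff1_id.
Qed.

(** In charts, [diff1 (twisted a)] is a partial differential at [(a, 1)] of the
    smooth map [(a, x) |-> twisted a x], and differentials of smooth maps along
    fixed vectors are smooth. *)
Lemma diff1_twisted_smooth :
  smooth_wrt (atlas G) (@vec_atlas 'M[R]_m) (fun a => lin1_mx (diff1 (twisted a))).
Proof.
have [hG hH] := (manifold_atlas G, manifold_atlas H).
apply: smooth_wrt_vec => // c Ac k.
have [cc cP] := (atl_chart hG Ac, chart_atP (1%g : H)).
have [ck sk] := twisted_smooth.
pose Psi (p : 'rV[R]_n * V) := phi (twisted (coordV c p.1) (coordV phi p.2)).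
pose U := prod_chart c phi @` (dom (prod_chart c phi) `&`
  (fun p : G * H => twisted p.1 p.2) @^-1` dom phi).
have oU : open U.
  apply: chart_img_open_sub; first exact: prod_chartP.
  by move/continuousP: ck; apply; exact: chart_dom_open cP.
have sPsi : smooth_on U Psi.
  apply: (sk (prod_chart c phi) phi); last exact: chart_at_atlas.
  by exists c, phi; split=> //; exact: chart_at_atlas.
have U1 v : (c @` dom c) v -> U (v, phi 1%g).
  move=> [a ca <-]; exists (a, 1%g) => //; split; rewrite /= ?twisted1.
    by split=> //; exact: chart_at_dom.
  exact: chart_at_dom.
have oI := chart_img_open cc.
have fV q := @finite_frame_mx R 1 q.
apply: Ck_on_mx => // i j.
apply: (@Ck_on_eq _ _ _ _ _
  (fun v => mx_coord 0 j ('d Psi (v, phi 1%g) (0, delta_mx 0 i)))) => //.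
  move=> v Iv; have [_ [_ E]] := diff_slice ((sPsi 1%N).1 _ (U1 v Iv)).
  by rewrite -E /mx_coord mxE.
apply: (@Ck_on_linear_comp R k _ _ _ _ _ (mx_coord 0 j)) => //.
  exact: mx_coord_continuous.
apply: (@Ck_on_comp R k _ _ _ _ U (fun v => (v, phi 1%g))
  (fun p => 'd Psi p (0, delta_mx 0 i))) => //.
- exact: (finite_frame_pair (fV n) (fV m)).
- apply: Ck_on_pair => //; last exact: Ck_on_cst.
  by apply: (@Ck_on_linear _ k _ _ _ idfun) => x; apply: cvg_id.
- exact: (sPsi k.+1).2.
Qed.

End Twisted.

Theorem proposition2p4 (R : realType) (n m : nat)
    (G : lieGroupType R n) (H : lieGroupType R m)
    (Theta : G -> H -> H) (hTheta : lie_action Theta)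
    (D : G -> H) (hD : crossed_hom Theta D) :
  representation
    (fun (a : G) (u : lie_alg H) => Ad (D a) (tilde_action Theta a u)).
Proof.
have -> : (fun a (u : lie_alg H) => Ad (D a) (tilde_action Theta a u)) =
    (fun a u => diff1 (twisted Theta D a) u).
  by apply/funext => a; apply/funext => u; exact: Ad_tilde.
have M := diff1_twistedM hTheta hD; have id1 := diff1_twisted1 hTheta hD.
split=> [a|a|a b u|].
- exact: linearP.
- by exists (diff1 (twisted Theta D (a^-1)%g)) => u; rewrite -M ?mulVg ?mulgV id1.
- exact: M.
- exact: diff1_twisted_smooth.
Qed.
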